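(* Let $q$ be any power of a prime $p$ and let $U=U(q)$ be as in the context. For $j\in\{1,\dots,12\}$ write $X_j=X_{\alpha_j}$. Every $\chi\in\operatorname{Irr}(U)$ lies in exactly one of the following classes, and the classes have the stated numbers of characters and degrees: \begin{enumerate} \item $X_{12}\not\subseteq\ker\chi$: exactly $q^3(q-1)$ characters, all of degree $q^4$. \item $X_{12}\subseteq\ker\chi$, $X_{11}\not\subseteq\ker\chi$: exactly $q^4(q-1)$ characters, all of degree $q^3$. \item $X_{11}X_{12}\subseteq\ker\chi$ and $X_8,X_9,X_{10}\not\subseteq\ker\chi$: if $q$ is odd, exactly $q(q-1)^3$ characters, all of degree $q^3$; if $q$ is even, exactly $(q-1)^3$ characters of degree $q^3$ and exactly $4(q-1)^4$ characters of degree $q^3/2$, and no others. \item For each of the three choices $\{i,j,k\}=\{8,9,10\}$ with $i<j$: $X_kX_{11}X_{12}\subseteq\ker\chi$ and $X_i,X_j\not\subseteq\ker\chi$: exactly $(q-1)^3$ characters of degree $q^3$ and exactly $q^2(q-1)^2$ characters of degree $q^2$, and no others. \item For each $i\in\{8,9,10\}$: $X_j\subseteq\ker\chi$ for all $j\in\{8,9,10,11,12\}\setminus\{i\}$ and $X_i\not\subseteq\ker\chi$: exactly $(q-1)^2$ characters of degree $q^3$ and exactly $q^2(q-1)$ characters of degree $q^2$, and no others. \item $X_j\subseteq\ker\chi$ for $j=8,\dots,12$ and $X_5,X_6,X_7\not\subseteq\ker\chi$: exactly $q^2(q-1)^3$ characters, all of degree $q$. \item For each choice $\{i,j,k\}=\{5,6,7\}$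 with $i<j$: $X_j'\subseteq\ker\chi$ for $j'\in\{k,8,9,10,11,12\}$ and $X_i,X_j\not\subseteq\ker\chi$: exactly $q^2(q-1)^2$ characters, all of degree $q$. \item For each $i\in\{5,6,7\}$: $X_j\subseteq\ker\chi$ for all $j\in\{5,\dots,12\}\setminus\{i\}$ and $X_i\not\subseteq\ker\chi$: exactly $q^2(q-1)$ characters, all of degree $q$. \item $X_j\subseteq\ker\chi$ for all $j=5,\dots,12$: exactly $q^4$ characters, all linear (degree $1$). \end{enumerate}
   Context: Let $q$ be a power of a prime $p$ and $\mathbb{F}_q$ the field with $q$ elements. Let $\Phi$ be a root system of type $D_4$ with simple roots $\alpha_1,\alpha_2,\alpha_3,\alpha_4$, where $\alpha_3$ is the central node of the Dynkin diagram (so $\alpha_1,\alpha_2,\alpha_4$ are pairwise orthogonal and each is joined to $\alpha_3$). The positive roots are $\alpha_1,\dots,\alpha_4$ and $\alpha_5=\alpha_1+\alpha_3$, $\alpha_6=\alpha_2+\alpha_3$, $\alpha_7=\alpha_3+\alpha_4$, $\alpha_8=\alpha_1+\alpha_2+\alpha_3$, $\alpha_9=\alpha_1+\alpha_3+\alpha_4$, $\alpha_{10}=\alpha_2+\alpha_3+\alpha_4$, $\alpha_{11}=\alpha_1+\alpha_2+\alpha_3+\alpha_4$, $\alpha_{12}=\alpha_1+\alpha_2+2\alpha_3+\alpha_4$. Let $U=U(q)$ be the Sylow $p$-subgroup (maximal unipotent subgroup generated by positive root elements) of the Chevalley group $D_4(q)$, generated by root elements $x_i(t)=x_{\alpha_i}(t)$,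 $i=1,\dots,12$, $t\in\mathbb{F}_q$. Concretely: $x_i(t)x_i(u)=x_i(t+u)$; every element of $U$ is uniquely $x_1(d_1)x_2(d_2)\cdots x_{12}(d_{12})$ with $d_i\in\mathbb{F}_q$, so $|U|=q^{12}$; and with $[a,b]=a^{-1}b^{-1}ab$ the commutators are $[x_1(t),x_3(u)]=x_5(tu)$, $[x_1(t),x_6(u)]=x_8(-tu)$, $[x_1(t),x_7(u)]=x_9(tu)$, $[x_1(t),x_{10}(u)]=x_{11}(-tu)$, $[x_2(t),x_3(u)]=x_6(tu)$, $[x_2(t),x_5(u)]=x_8(-tu)$, $[x_2(t),x_7(u)]=x_{10}(tu)$, $[x_2(t),x_9(u)]=x_{11}(-tu)$, $[x_3(t),x_4(u)]=x_7(tu)$, $[x_3(t),x_{11}(u)]=x_{12}(-tu)$, $[x_4(t),x_5(u)]=x_9(-tu)$, $[x_4(t),x_6(u)]=x_{10}(-tu)$, $[x_4(t),x_8(u)]=x_{11}(-tu)$, $[x_5(t),x_{10}(u)]=x_{12}(-tu)$, $[x_6(t),x_9(u)]=x_{12}(-tu)$, $[x_7(t),x_8(u)]=x_{12}(tu)$, and all other $[x_i(t),x_j(u)]$ with $i<j$ equal $1$. The root subgroup is $X_{\alpha_i}=\{x_i(t):t\in\mathbb{F}_q\}\cong(\mathbb{F}_q,+)$. $\operatorname{Irr}(U)$ denotes the set of complex irreducible characters of $U$. *)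

(* Defs.v *)
From HB Require Import structures.
From mathcomp Require Import all_boot all_order all_algebra all_fingroup all_solvable all_field all_character.
Set Implicit Arguments. Unset Strict Implicit. Unset Printing Implicit Defensive.
Import GRing.Theory Num.Theory.
Local Open Scope ring_scope.

(* Commutator table of U(q) for D4: [x_i(t), x_j(u)] = x_k(+/- t u) for i < j.
   D4_comm i j = Some (k, true)  means  x_k(-tu);
   D4_comm i j = Some (k, false) means  x_k(tu);
   None means the commutator is 1. *)
Definition D4_comm (i j : nat) : option (nat * bool) :=
  match i, j with
  | 1, 3 => Some (5, false)  | 1, 6 => Some (8, true)
  | 1, 7 => Some (9, false)  | 1, 10 => Some (11, true)
  | 2, 3 => Some (6, false)  | 2, 5 => Some (8, true)
  | 2, 7 => Some (10, false) | 2, 9 => Some (11, true)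
  | 3, 4 => Some (7, false)  | 3, 11 => Some (12, true)
  | 4, 5 => Some (9, true)   | 4, 6 => Some (10, true)
  | 4, 8 => Some (11, true)  | 5, 10 => Some (12, true)
  | 6, 9 => Some (12, true)  | 7, 8 => Some (12, false)
  | _, _ => None
  end.

Definition D4_word (gT : finGroupType) (F : finFieldType) (x : nat -> F -> gT)
  (d : {ffun 'I_12 -> F}) : gT :=
  (\prod_(i < 12) x i.+1 (d i))%g.

(* G is the Sylow p-subgroup U(q) of D4(q), q = #|F|, with root elements
   x_i(t) = x i t (i = 1..12), in the sense of the context: additivity,
   unique normal form x_1(d_1)...x_12(d_12), and the commutator relations. *)
Definition D4_unipotent (gT : finGroupType) (F : finFieldType) (G : {group gT})
  (x : nat -> F -> gT) : Prop :=
  [/\ (forall i (t u : F), (0 < i <= 12)%N -> (x i t * x i u)%g = x i (t + u)%R),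
      G :=: [set D4_word x d | d : {ffun 'I_12 -> F}],
      injective (D4_word x) &
      (forall i j (t u : F), (0 < i)%N -> (i < j)%N -> (j <= 12)%N ->
         [~ x i t, x j u]%g =
         match D4_comm i j with
         | Some (k, true) => x k (- (t * u))%R
         | Some (k, false) => x k (t * u)%R
         | None => 1%g
         end)].

Definition D4rootX (gT : finGroupType) (F : finFieldType) (x : nat -> F -> gT) (j : nat)
  : {set gT} := [set x j t | t : F].

Definition D4inker (gT : finGroupType) (F : finFieldType) (G : {group gT})
  (x : nat -> F -> gT) (j : nat) (i : Iirr G) : bool :=
  D4rootX x j \subset cfker 'chi[G]_i.

Definition D4ndeg (gT : finGroupType) (G : {group gT}) (P : pred (Iirr G)) (d : nat) : nat :=
  #|[set i : Iirr G | P i && ('chi[G]_i 1%g == d%:R)]|.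

Definition D4degs_in (gT : finGroupType) (G : {group gT}) (P : pred (Iirr G)) (ds : seq nat)
  : Prop :=
  forall i : Iirr G, P i -> exists2 d, d \in ds & 'chi[G]_i 1%g = d%:R.

Definition D4setinker (gT : finGroupType) (G : {group gT}) (A : {set gT}) (i : Iirr G) : bool :=
  A \subset cfker 'chi[G]_i.

(* Main.v *)
Require Import Defs.
From HB Require Import structures.
From mathcomp Require Import all_boot all_order all_algebra all_fingroup all_solvable all_field all_character.
From mathcomp Require Import ring.
Set Implicit Arguments. Unset Strict Implicit. Unset Printing Implicit Defensive.
Import Order.TTheory GRing.Theory Num.Theory.

(** Let [B = X_3 X_5 .. X_12] and [T = X_1 X_2 X_4].  Modulo [X_12], [U] is the
semidirect product of the abelian normal subgroup [B] by the abelian group [T],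
so a character [chi] over a linear character [theta] of [B] has degree
[|T : T_theta|].  If a set [S] of irreducible characters of [U] is the set of
those lying over the members of a set [Q] of linear characters of [B], then
[sum_(chi in S) chi(1)^2 = |Q| * |U : B|]; this turns the counts into counts of
coefficient vectors [(b3, b5, .., b11)] of [theta] with a given stabilizer
order.  The stabilizer is the solution set in [(t1, t2, t4)] of seven explicit
equations; on the family [F_(8,9,10)] it lies on a line, given by a quadratic
equation in the parameter, and this is where characteristic 2 differs.

If [chi] is nontrivial on [X_12], then the restriction of [chi] to the abelian
normal subgroup [A = X_8 .. X_12] contains a character trivial on
[X_8, .., X_11]; its inertia group is [A T], so [chi(1) = q^4], and the number
of these characters follows from the sum of squares of the degrees. *)

(** * Characters over a linear character of a normal subgroup *)

Section NormalSubgroupCharacters.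
Local Open Scope group_scope.
Local Open Scope ring_scope.
Variables (gT : finGroupType) (G B : {group gT}).
Hypothesis nsBG : B <| G.

(** Since [G] normalizes [A], having [A] in the kernel of ['chi_t] puts it in the core of that
    kernel, hence in the kernel of the induced character and of each of its constituents, ['chi_i]
    among them. *)
Lemma sub_cfker_constt_Res (A : {group gT}) (i : Iirr G) (t : Iirr B) :
    t \in irr_constt ('Res[B] 'chi_i) -> A \subset B -> G \subset 'N(A) ->
  (A \subset cfker 'chi_t) = (A \subset cfker 'chi_i).
Proof.
move=> ti sAB nAG; have sBG := normal_sub nsBG; apply/idP/idP => kA.
  have: i \in irr_constt ('Ind[G] 'chi_t) by rewrite constt_Ind_Res.
  move/(cfker_constt (cfInd_char _ (irr_char _))); apply: subset_trans.
  by rewrite cfker_Ind_irr // sub_gcore.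
apply: subset_trans (cfker_constt (cfRes_char _ (irr_char _)) ti).
exact: sub_cfker_Res.
Qed.

(** Double counting of pairs [(i, t)] with weight ['chi_t 1 * '['Res 'chi_i, 'chi_t] * 'chi_i 1].
    Summing over [t] gives the squared degree of ['chi_i]; by Frobenius reciprocity, summing over
    [i] gives the degree of an induced linear character. Pairs with nonzero weight are in [S]
    exactly when they are in [Q]. *)
Lemma sum_square_constt_Res (S : pred (Iirr G)) (Q : pred (Iirr B)) :
    (forall i t, t \in irr_constt ('Res[B] 'chi_i) -> S i = Q t) ->
    (forall t, Q t -> 'chi_t \is a linear_char) ->
  \sum_(i | S i) 'chi_i 1%g ^+ 2 = (#|[pred t | Q t]| * #|G : B|)%:R.
Proof.
move=> SQ linQ; have sBG := normal_sub nsBG.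
transitivity (\sum_(i | S i) \sum_t
    'chi_t 1%g * ('['Res[B] 'chi_i, 'chi_t] * 'chi_i 1%g)).
  apply: eq_bigr => i _; rewrite expr2.
  rewrite -[X in X * _](cfRes1 B) {1}(cfun_sum_cfdot ('Res[B] 'chi_i)).
  rewrite sum_cfunE mulr_suml; apply: eq_bigr => t _.
  by rewrite cfunE; ring.
rewrite exchange_big /= (bigID Q) /= [X in _ + X]big1 ?addr0 => [|t nQt]; last first.
  apply: big1 => i Si; case ti: (t \in irr_constt ('Res[B] 'chi_i)).
    by rewrite -(SQ i t ti) Si in nQt.
  by move/negbT: ti; rewrite irr_consttE negbK => /eqP->; rewrite mul0r mulr0.
rewrite natrM -[X in X%:R * _]sum1_card natr_sum mulr_suml; apply: eq_bigr => t Qt.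
have -> : 1 * #|G : B|%:R = 'Ind[G] 'chi_t 1%g.
  by rewrite cfInd1 // lin_char1 ?linQ // mulrC.
rewrite [in RHS](cfun_sum_cfdot ('Ind[G] 'chi_t)) sum_cfunE [RHS](bigID S) /=.
rewrite [X in _ = _ + X]big1 ?addr0 => [|i nSi]; last first.
  case ti: (t \in irr_constt ('Res[B] 'chi_i)).
    by rewrite (SQ i t ti) Qt in nSi.
  move/negbT: ti; rewrite irr_consttE negbK => /eqP ti0.
  by rewrite cfunE -Frobenius_reciprocity cfdotC ti0 conjC0 mul0r.
apply: eq_bigr => i _; rewrite (lin_char1 (linQ t Qt)) mul1r cfunE.
rewrite -Frobenius_reciprocity cfdotC; congr (_ * _).
by rewrite conj_natr // Cnat_cfdot_char ?cfRes_char ?irr_char.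
Qed.

(* Modulo [cfker 'chi_t] the inertia group is abelian, so the Clifford
   correspondents of the characters over ['chi_t] are linear. *)
Lemma irr1_abelian_inertia (T0 : {group gT}) (i : Iirr G) (t : Iirr B) :
    'chi_t \is a linear_char -> abelian T0 -> 'I_G['chi_t] = (B * T0)%g ->
    t \in irr_constt ('Res[B] 'chi_i) ->
  'chi_i 1%g = #|G : 'I_G['chi_t]|%:R.
Proof.
move=> lin_t abT0 defI ti; have sBG := normal_sub nsBG.
set M := 'I_G['chi_t]%G.
have nsBM : B <| M := normal_Inertia _ sBG.
have sBM := normal_sub nsBM.
have sT0M : T0 \subset M by rewrite /= defI mulG_subr.
pose K := cfker_group 'chi_t.
have nKM : M \subset 'N(K).
  apply/subsetP => y /setIP[_ Iy]; rewrite inE -cfker_conjg; last first.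
    exact: (subsetP (norm_inertia 'chi_t)).
  by rewrite (inertiaJ Iy).
have sKB : K \subset B by exact: cfker_sub.
have abMK : abelian (M / K).
  rewrite /= defI quotientMl ?(subset_trans sBM) // abelianM.
  rewrite sub_der1_abelian ?lin_char_der1 //= quotient_abelian //=.
  rewrite quotient_cents2 ?(subset_trans sBM) ?(subset_trans sT0M) //.
  rewrite commGC.
  rewrite gen_subG; apply/subsetP => _ /imset2P[b y Bb T0y ->].
  have My : y \in 'I['chi_t] by have /setIP[] := subsetP sT0M y T0y.
  have By : (b ^ y)%g \in B.
    by rewrite memJ_norm // (subsetP (norm_inertia 'chi_t)).
  rewrite /K /= cfkerEirr inE commgEl.
  by rewrite lin_charM ?groupV // (inertia_valJ _ My) -lin_charM ?groupV // mulVg.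
have [_ _ bij _ _] := constt_Inertia_bijection t nsBG.
have: i \in irr_constt ('Ind[G] 'chi_t) by rewrite constt_Ind_Res.
rewrite -bij => /imsetP[s sA ->].
have [irrI _ _ _ _] := constt_Inertia_bijection t nsBG.
rewrite cfIirrE ?irrI // cfInd1 ?Inertia_sub //.
suffices /lin_char1-> : 'chi_s \is a linear_char by rewrite mulr1.
rewrite lin_irr_der1; apply: subset_trans (der1_min nKM abMK) _.
have : s \in irr_constt ('Ind[M] 'chi_t) by [].
move/(cfker_constt (cfInd_char _ (irr_char _))); apply: subset_trans.
by rewrite cfker_Ind_irr // sub_gcore.
Qed.

Lemma sum_square_cfker_sub :
  \sum_(i | B \subset cfker 'chi[G]_i) 'chi_i 1%g ^+ 2 = #|G : B|%:R.
Proof.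
rewrite -card_quotient ?normal_norm // -irr_sum_square.
transitivity (\sum_(i | B \subset cfker 'chi[G]_i) `|'chi_i 1%g| ^+ 2).
  by apply: eq_bigr => i _; rewrite ger0_norm // ltW ?irr1_gt0.
rewrite -sum_norm_irr_quo //; apply: eq_bigr => i _.
by rewrite morph1 ger0_norm // ltW ?irr1_gt0.
Qed.

End NormalSubgroupCharacters.

(** * Additive characters of a finite field *)

Section AdditiveCharacters.
Local Open Scope ring_scope.
Variable F : finFieldType.

Definition additive_character (f : F -> algC) :=
  f 0 = 1 /\ forall s t, f (s + t) = f s * f t.

(** Translation by [t] permutes the summands and multiplies the sum by [f t]. *)
Lemma additive_character_sum_neq0 f :
  additive_character f -> \sum_s f s != 0 -> forall t, f t = 1.
Proof.
move=> [_ fD] nz t; apply: (mulIf nz); rewrite mul1r mulr_sumr.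
rewrite [RHS](reindex (+%R t)) /=; last first.
  by exists (+%R (- t)) => s _ /=; ring.
by apply: eq_bigr => s _; rewrite fD.
Qed.

Lemma nontrivial_additive_character :
  exists2 f, additive_character f & exists t, f t != 1.
Proof.
have nt : [set: F]%G :!=: 1%g.
  apply/trivgPn; exists 1%R; rewrite ?inE //; exact: oner_neq0.
have [i nz_i] := has_nonprincipal_irr nt.
have lin : 'chi_i \is a linear_char.
  (* The group law on the carrier of [F] is addition, so commutativity of the group is [addrC]. *)
  by apply/char_abelianP; apply/centsP => s _ t _; apply: addrC.
exists ('chi_i : F -> algC); first split.
- exact: lin_char1.
- by move=> s t; have := lin_charM lin (in_setT s) (in_setT t).
apply/existsP; rewrite -negb_forall; apply: contra nz_i => /forallP f1.
rewrite -irr_eq1; apply/eqP/cfunP => t; rewrite cfun1E inE.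
exact/eqP.
Qed.

Variable phi : F -> algC.
Hypothesis phiP : additive_character phi.
Hypothesis phi_nt : exists t, phi t != 1.

Lemma additive_character_faithful b : (forall s, phi (b * s) = 1) -> b = 0.
Proof.
move=> kb; have [t] := phi_nt; apply: contraNeq => nb.
by rewrite -[t](mulVKf nb) kb.
Qed.

(** If [f] were orthogonal to every [phi (b * _)], all the sums of [h b] would vanish. Summing over
    [b] first leaves only the term [s = 0], which equals [q] and is nonzero. *)
Lemma additive_character_classification f :
  additive_character f -> exists b, forall s, f s = phi (b * s).
Proof.
move=> [f0 fD]; have [phi0 phiD] := phiP.
have phiN s : phi s * phi (- s) = 1 by rewrite -phiD subrr.
pose h b s := f s * phi (- (b * s)).
have hP b : additive_character (h b).
  split=> [|s t]; first by rewrite /h mulr0 oppr0 phi0 f0 mulr1.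
  by rewrite /h mulrDr opprD phiD fD; ring.
suffices [b nb] : exists b, \sum_s h b s != 0.
  exists b => s; have := additive_character_sum_neq0 (hP b) nb s.
  by rewrite /h => /(congr1 ( *%R^~ (phi (b * s)))) /=; rewrite mulrAC -mulrA phiN mulr1 mul1r.
apply/existsP; rewrite -negb_forall; apply/negP => /forallP z.
have: \sum_b \sum_s h b s = 0 by apply: big1 => b _; apply/eqP.
rewrite exchange_big (bigD1 0) //= [X in _ + X]big1 => [|s ns]; last first.
  rewrite -mulr_sumr; apply/eqP; rewrite mulf_eq0; apply/orP; right.
  (* For fixed [s] the map in [b] is itself an additive character; a nonzero sum makes it trivial,
     and faithfulness of [phi] then forces [s = 0]. *)
  apply: contraT => nz; have gP : additive_character (fun b => phi (- (b * s))).
    split=> [|a b]; first by rewrite mul0r oppr0.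
    by rewrite mulrDl opprD phiD.
  have /eqP := ns; case; apply: oppr_inj; rewrite oppr0.
  apply: additive_character_faithful => b.
  by rewrite mulNr mulrC; apply: (additive_character_sum_neq0 gP).
rewrite addr0 (eq_bigr (fun _ => 1)) => [|b _]; last first.
  by rewrite /h mulr0 oppr0 f0 phi0 mulr1.
rewrite sumr_const => /eqP; rewrite pnatr_eq0 => /eqP/card0_eq/(_ 0).
by rewrite inE.
Qed.

End AdditiveCharacters.

(** * Subgroups generated by root subgroups *)

(** The points where two linear characters agree form a subgroup. *)
Lemma lin_char_gen_eq (gT : finGroupType) (A : {set gT})
    (f g : 'CF(<<A>>%G)) : f \is a linear_char -> g \is a linear_char ->
  {in A, forall a, f a = g a} -> f = g.
Proof.
move=> linf ling eqfg.
have gS : group_set [set a in <<A>>%G | f a == g a].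
  apply/group_setP; split=> [|a b]; first by rewrite inE group1 !lin_char1 /=.
  rewrite !inE => /andP[Ga /eqP fa] /andP[Gb /eqP fb].
  by rewrite groupM // !lin_charM // fa fb /=.
apply/cfunP => a; case Ga: (a \in <<A>>%G); last by rewrite !cfun0 ?Ga.
suffices /subsetP/(_ _ Ga) : <<A>>%G \subset Group gS.
  by rewrite inE Ga => /eqP.
rewrite gen_subG; apply/subsetP => b Ab.
by rewrite inE mem_gen //= eqfg.
Qed.

(** The table covers [i < j] only; exchanging the arguments inverts the commutator and so flips the
    sign. The diagonal has no table entry. *)
Definition D4_commS (i j : nat) : option (nat * bool) :=
  if (i < j)%N then D4_comm i j
  else if D4_comm j i is Some (k, b) then Some (k, ~~ b) else None.

Definition is_root (j : nat) := (0 < j <= 12)%N.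

(** This and the next tests are booleans on root labels: for explicit lists, normality and
    commutation of root groups are settled by evaluating the commutator table. *)
Definition normalizes (s s' : seq nat) :=
  all (fun i => all (fun j =>
    if D4_commS j i is Some (k, _) then k \in s' else true) s') s.

Definition centralizes (s s' : seq nat) :=
  all (fun i => all (fun j => D4_commS j i == None) s') s.

(** Root subgroups can then be split off one at a time from the front, which bounds the order of the
    generated group from above. *)
Fixpoint normal_chain (s : seq nat) :=
  if s is j :: s' then normalizes [:: j] s' && normal_chain s' else true.

Lemma D4_comm_root i j k b : D4_comm i j = Some (k, b) -> is_root k.
Proof.
case: i => [|[|[|[|[|[|[|[|i]]]]]]]] //=;
  by case: j => [|[|[|[|[|[|[|[|[|[|[|[|j]]]]]]]]]]]] //= [<- _].
Qed.

Section RootSubgroups.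
Local Open Scope group_scope.
Variables (gT : finGroupType) (F : finFieldType) (G : {group gT}).
Variable (x : nat -> F -> gT).
Hypothesis HU : D4_unipotent G x.
Local Notation q := #|F|.

Lemma root_eltD i t u : is_root i -> x i t * x i u = x i (t + u)%R.
Proof. by case: HU => H _ _ _; apply: H. Qed.

Lemma root_elt0 i : is_root i -> x i 0%R = 1.
Proof.
move=> ri; apply: (mulgI (x i 0%R)).
by rewrite root_eltD // addr0 mulg1.
Qed.

Lemma root_eltV i t : is_root i -> (x i t)^-1 = x i (- t)%R.
Proof.
move=> ri; apply: (mulgI (x i t)).
by rewrite root_eltD // subrr root_elt0 // mulgV.
Qed.

Definition root_opt (o : option (nat * bool)) (u : F) : gT :=
  match o with
  | Some (k, true) => x k (- u)%R
  | Some (k, false) => x k u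
  | None => 1
  end.

Lemma root_elt_comm i j t u : is_root i -> is_root j ->
  [~ x i t, x j u] = root_opt (D4_commS i j) (t * u)%R.
Proof.
case: HU => _ _ _ H ri rj; rewrite /D4_commS.
have /andP[i0 i12] := ri; have /andP[j0 j12] := rj.
case: ltngtP => [ij|ji|<-].
- by rewrite H.
- rewrite -invg_comm H // mulrC.
  case E: (D4_comm j i) => [[k []]|] /=; last exact: invg1.
    by rewrite root_eltV ?opprK // (D4_comm_root E).
  by rewrite root_eltV // (D4_comm_root E).
- have -> : D4_comm i i = None.
    by case: (i) => [|[|[|[|[|[|[|[|[|[|[|[|?]]]]]]]]]]]].
  by apply/eqP/commgP; rewrite /commute !root_eltD // addrC.
Qed.

Lemma root_conjE i j t u : is_root i -> is_root j ->
  x j u ^ x i t =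
    match D4_commS j i with
    | Some (k, true) => x j u * x k (- (u * t))%R
    | Some (k, false) => x j u * x k (u * t)%R
    | None => x j u
    end.
Proof.
move=> ri rj; rewrite conjg_mulR root_elt_comm //.
by case: D4_commS => [[k []]|] //=; rewrite mulg1.
Qed.

Definition root_gen (s : seq nat) : {group gT} :=
  <<[set g | has (fun j => g \in D4rootX x j) s]>>%G.

Lemma mem_root_gen s j t : j \in s -> x j t \in root_gen s.
Proof.
move=> sj; apply: mem_gen; rewrite inE; apply/hasP; exists j => //.
exact: imset_f.
Qed.

Lemma root_gen_subP s (H : {group gT}) :
  reflect (forall j t, j \in s -> x j t \in H) (root_gen s \subset H).
Proof.
apply: (iffP idP) => [/subsetP sH j t sj|H1].
  exact/sH/mem_root_gen.
rewrite gen_subG; apply/subsetP => g; rewrite inE => /hasP[j sj /imsetP[t _ ->]].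
exact: H1.
Qed.

Lemma root_gen_sub_all s (H : {group gT}) :
  (root_gen s \subset H) = all (fun j => D4rootX x j \subset H) s.
Proof.
apply/root_gen_subP/allP => [sH j sj|sH j t sj].
  by apply/subsetP => _ /imsetP[t _ ->]; apply: sH.
by apply: (subsetP (sH j sj)); apply: imset_f.
Qed.

Lemma root_gen_subset s s' :
  all [in s'] s -> root_gen s \subset root_gen s'.
Proof.
by move/allP=> ss; apply/root_gen_subP => j t /ss; apply: mem_root_gen.
Qed.

Lemma root_gen_norm s s' : all is_root s -> all is_root s' -> normalizes s s' ->
  root_gen s \subset 'N(root_gen s').
Proof.
move=> /allP rs /allP rs' /allP nss.
apply/root_gen_subP => i t si; rewrite inE -genJ gen_subG.
apply/subsetP => _ /imsetP[g + ->]; rewrite inE => /hasP[j s'j /imsetP[u _ ->]].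
rewrite root_conjE ?(rs i) ?(rs' j) //; have := allP (nss i si) j s'j.
by case: D4_commS => [[k []]|] s'k; rewrite ?groupM ?mem_root_gen.
Qed.

Lemma root_gen_cent s s' : all is_root s -> all is_root s' -> centralizes s s' ->
  root_gen s \subset 'C(root_gen s').
Proof.
move=> /allP rs /allP rs' /allP css.
apply/root_gen_subP => i t si; rewrite /= cent_gen.
apply/centP => g; rewrite inE => /hasP[j s'j /imsetP[u _ ->]].
apply/commute_sym/commgP; apply/eqP; rewrite root_elt_comm ?(rs i) ?(rs' j) //.
by rewrite (eqP (allP (css i si) j s'j)).
Qed.

Lemma root_gen_abelian_quotient s s' :
    all is_root s -> all is_root s' -> normalizes s s' ->
    all (fun i => all (fun j =>
      if D4_commS j i is Some (k, _) then k \in s' else true) s) s ->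
  abelian (root_gen s / root_gen s').
Proof.
move=> /[dup] rss /allP rs rs' nss /allP css; have nN := root_gen_norm rss rs' nss.
have sA := subset_gen [set g | has (fun j => g \in D4rootX x j) s].
rewrite /= quotient_gen ?(subset_trans sA) // abelian_gen.
rewrite /abelian quotient_cents2 ?(subset_trans sA) // gen_subG.
apply/subsetP => _ /imset2P[g h + + ->]; rewrite !inE.
move=> /hasP[j sj /imsetP[u _ ->]] /hasP[i si /imsetP[t _ ->]].
rewrite root_elt_comm ?rs //; have := allP (css i si) j sj.
case: D4_commS => [[k []]|] /= s'k; rewrite ?group1 //; exact: mem_root_gen.
Qed.

(** As [X_j] normalizes the group of the remaining roots, their join is a product set. *)
Lemma root_gen_cons j s g : is_root j -> all is_root s -> normalizes [:: j] s ->
  g \in root_gen (j :: s) -> exists t, exists2 h, h \in root_gen s & g = x j t * h.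
Proof.
move=> rj rs njs.
have nJ : root_gen [:: j] \subset 'N(root_gen s).
  by apply: root_gen_norm => //=; rewrite rj.
have gX : group_set (D4rootX x j).
  apply/group_setP; split=> [|_ _ /imsetP[t _ ->] /imsetP[u _ ->]].
    by apply/imsetP; exists 0%R; rewrite ?root_elt0.
  by rewrite root_eltD // imset_f.
have eJ : root_gen [:: j] \subset Group gX.
  by apply/root_gen_subP => i t; rewrite inE => /eqP->; apply: imset_f.
have: root_gen (j :: s) \subset root_gen [:: j] <*> root_gen s.
  apply/root_gen_subP => i t; rewrite inE => /orP[/eqP->|si].
    by rewrite mem_gen // inE mem_root_gen ?inE.
  by rewrite mem_gen // inE orbC mem_root_gen.
rewrite norm_joinEl // => /subsetP sub /sub /mulsgP[a h /(subsetP eJ)].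
by move=> /imsetP[t _ ->] hs ->; exists t, h.
Qed.

Lemma card_root_gen_le s : all is_root s -> normal_chain s ->
  (#|root_gen s| <= q ^ size s)%N.
Proof.
elim: s => [_ _|j s IH /andP[rj rs] /andP[njs cs]].
  have /trivGP-> : root_gen [::] \subset 1%G by apply/root_gen_subP.
  by rewrite cards1.
apply: (@leq_trans #|[set x j p.1 * p.2 | p in setX [set: F] (root_gen s)]|).
  apply/subset_leq_card/subsetP => g /(root_gen_cons rj rs njs)[t [h hs ->]].
  by apply/imsetP; exists (t, h); rewrite // !inE.
apply: leq_trans (leq_imset_card _ _) _.
by rewrite cardsX cardsT expnS leq_mul // IH.
Qed.

(** The normal-form words with coordinates supported on [s] lie in the group, and uniqueness of the
    normal form makes them distinct. *)
Lemma card_root_gen_ge s : all is_root s -> uniq s ->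
  (q ^ size s <= #|root_gen s|)%N.
Proof.
case: HU => _ _ inj _ rs us.
pose D := [pred i : 'I_12 | i.+1 \in s].
(* The ordinal [i] stands for the root [i.+1], so the count is shifted from 0..11 to 1..12. *)
have cD : #|D| = size s.
  rewrite -sum1_card (eq_bigl (fun i : 'I_12 => i.+1 \in s)) //.
  rewrite -(big_mkord (fun i => i.+1 \in s) (fun=> 1%N)).
  rewrite -(big_add1 _ _ 0 13 (fun i => i \in s) (fun=> 1%N)).
  rewrite sum1_count /index_iota -size_filter; apply/perm_size/uniq_perm => //.
    exact/filter_uniq/iota_uniq.
  move=> i; rewrite mem_filter mem_iota andb_idr //.
  by move/(allP rs).
rewrite -cD -[q]cardsT -(card_pffun_on 0%R D) -(card_imset _ inj).
apply/subset_leq_card/subsetP => _ /imsetP[d /pffun_onP[dD _] ->].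
apply: group_prod => i _; case Di: (i.+1 \in s); first exact: mem_root_gen.
rewrite (supportP dD) ?root_elt0 ?group1 //; first by rewrite /is_root /= ltn_ord.
by rewrite inE /= Di.
Qed.

Lemma card_root_gen s : all is_root s -> uniq s -> normal_chain s ->
  #|root_gen s| = (q ^ size s)%N.
Proof.
by move=> rs us cs; apply/eqP; rewrite eqn_leq card_root_gen_le ?card_root_gen_ge.
Qed.

Lemma D4_gen : G = root_gen (iota 1 12).
Proof.
case: HU => _ defG inj _; apply: group_inj; apply/eqP; rewrite eqEcard.
rewrite (card_root_gen (s := iota 1 12)) // defG card_imset // card_ffun.
rewrite card_ord leqnn andbT; apply/subsetP => _ /imsetP[d _ ->].
apply: group_prod => i _; apply: mem_root_gen.
by rewrite mem_iota; apply: (ltn_ord i).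
Qed.

Lemma card_D4 : #|G| = (q ^ 12)%N.
Proof. by rewrite D4_gen card_root_gen. Qed.

Definition normal_roots s := all is_root s && normalizes (iota 1 12) s.

Lemma root_gen_normal s : normal_roots s -> root_gen s <| G.
Proof.
case/andP=> rs ns; rewrite /normal D4_gen root_gen_norm // andbT.
apply: root_gen_subset; apply/allP => j /(allP rs).
by move=> rj; have := mem_iota 1 12 j; rewrite [X in _ = X]rj => ->.
Qed.

End RootSubgroups.

(** Pushes conjugation by root elements through products until only a word in root elements is
    left. *)
Ltac root_conj_simpl HU :=
  repeat match goal with
  | |- context [conjg (mulg ?a ?b) ?c] => rewrite (conjMg a b c)
  | |- context [conjg (?x ?j ?u) (?x ?i ?t)] =>
      rewrite (root_conjE HU (i := i) (j := j) t u isT isT) /D4_commS /=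
  end.

(** * Characters trivial on the highest root subgroup *)

(** These are the positive roots involving [alpha_3]. A sum of two of them contains [alpha_3] twice,
    so it can only be [alpha_12]; this makes [B / X_12] abelian. The complementary roots 1, 2, 4 are
    pairwise orthogonal, so [T] is abelian. *)
Definition B_roots := [:: 3; 5; 6; 7; 8; 9; 10; 11; 12].
Definition T_roots := [:: 1; 2; 4].

Section LinearCoefficients.
Local Open Scope group_scope.
Local Open Scope ring_scope.
Variables (gT : finGroupType) (F : finFieldType) (G : {group gT}).
Variable (x : nat -> F -> gT).
Hypothesis HU : D4_unipotent G x.
Variable phi : F -> algC.
Hypothesis phiP : additive_character phi.
Hypothesis phi_nt : exists t, phi t != 1.
Local Notation q := #|F|.

(** Coordinate of [f] on [X_j] under the self-duality of [F] given by [phi]; the default 0 is not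
    reached when [f] is linear on a group containing [X_j]. *)
Definition root_coef (f : gT -> algC) (j : nat) : F :=
  odflt 0 [pick b | [forall s, f (x j s) == phi (b * s)]].

Lemma phiD s t : phi (s + t) = phi s * phi t.
Proof. by case: phiP. Qed.

Lemma phi_mul_inj a b : (forall s, phi (a * s) = phi (b * s)) -> a = b.
Proof.
move=> ab; apply/eqP; rewrite -subr_eq0; apply/eqP.
apply: (additive_character_faithful phi_nt) => s.
rewrite mulrBl phiD ab -phiD subrr; by case: phiP.
Qed.

Section OneCharacter.
Variables (H : {group gT}) (f : 'CF(H)) (j : nat).
Hypotheses (linf : f \is a linear_char) (rj : is_root j).
Hypothesis Hj : forall t, x j t \in H.

Lemma root_coefE s : f (x j s) = phi (root_coef f j * s).
Proof.
rewrite /root_coef; case: pickP => [b /forallP/(_ s)/eqP //|nb].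
have fP : additive_character (fun s => f (x j s)).
  split=> [|u t]; first by rewrite (root_elt0 HU) // lin_char1.
  by rewrite -(root_eltD HU) // lin_charM.
have [b fb] := additive_character_classification phiP phi_nt fP.
by have /forallP[] := negbT (nb b) => u; apply/eqP.
Qed.

Lemma sub_cfker_root : (D4rootX x j \subset cfker f) = (root_coef f j == 0).
Proof.
rewrite cfkerEchar ?lin_charW //; apply/subsetP/eqP => [kf|f0 _ /imsetP[t _ ->]].
  apply: phi_mul_inj => s; rewrite -root_coefE mul0r.
  have := kf (x j s) (imset_f _ isT); rewrite inE => /andP[_ /eqP->].
  by rewrite lin_char1 //; case: phiP.
by rewrite inE Hj root_coefE f0 mul0r lin_char1 //; case: phiP => ->; rewrite eqxx.
Qed.

End OneCharacter.

Lemma mem_inertia_root_gen s (f : 'CF(root_gen x s)) g :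
    f \is a linear_char -> g \in 'N(root_gen x s) ->
    (* The conjugate of [f] by [g] is evaluated at conjugates by the inverse of [g]; the proof
       passes to that inverse so that this condition can be checked on [x j u ^ g]. *)
    (forall j u, j \in s -> f (x j u ^ g)%g = f (x j u)) ->
  g \in 'I[f].
Proof.
move=> linf Ng fix_f; rewrite -groupV inE groupV Ng /=; apply/eqP.
apply: lin_char_gen_eq => //; first exact: cfConjg_lin_char.
move=> a; rewrite inE => /hasP[j sj /imsetP[u _ ->]].
by rewrite cfConjgE ?groupV // invgK fix_f.
Qed.

Local Notation B := (root_gen x B_roots).
Local Notation T := (root_gen x T_roots).
Local Notation Z := (root_gen x [:: 12]).

Lemma nsBG : (B <| G)%g. Proof. exact: (root_gen_normal HU). Qed.

Lemma nsZB : (Z <| B)%g.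
Proof.
rewrite /normal (root_gen_norm HU) // andbT.
exact: root_gen_subset.
Qed.

Lemma abelian_T : abelian T. Proof. exact: (root_gen_cent HU). Qed.

Lemma D4_mulBT : (B * T)%g = G.
Proof.
have nTB : T \subset 'N(B) by rewrite (root_gen_norm HU).
apply/eqP; rewrite eqEsubset; apply/andP; split.
  rewrite mul_subG ?(normal_sub nsBG) // (D4_gen HU).
  exact: root_gen_subset.
rewrite -norm_joinEr // {1}(D4_gen HU).
apply/root_gen_subP => j t.
have -> : (j \in iota 1 12) = (j \in B_roots) || (j \in T_roots).
  by case: j => [|[|[|[|[|[|[|[|[|[|[|[|[|j]]]]]]]]]]]]].
case/orP=> jr; rewrite mem_gen // inE; apply/orP; [left|right];
  exact: mem_root_gen.
Qed.

Definition tau (t : F * F * F) : gT := (x 1 t.1.1 * (x 2 t.1.2 * x 4 t.2))%g.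

Lemma im_tau : [set tau t | t : F * F * F] = T.
Proof.
apply/eqP; rewrite eqEsubset; apply/andP; split; apply/subsetP => g.
  by case/imsetP=> t _ ->; rewrite !groupM ?mem_root_gen.
move/(root_gen_cons HU); case=> // t1 [h1 /(root_gen_cons HU)[] // t2 [h2]].
move=> /(root_gen_cons HU)[] // t4 [h3].
have /trivgP-> : root_gen x [::] \subset 1%G by apply/root_gen_subP.
move=> /set1P-> -> -> ->; apply/imsetP; exists ((t1, t2), t4) => //.
by rewrite /tau mulg1.
Qed.

Lemma card_T : #|T| = (q ^ 3)%N. Proof. exact: (card_root_gen HU). Qed.
Lemma card_B : #|B| = (q ^ 9)%N. Proof. exact: (card_root_gen HU). Qed.

Lemma q_gt0 : (0 < q)%N. Proof. by apply/card_gt0P; exists 0. Qed.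

(** [tau] maps [q ^ 3] triples onto a group of order [q ^ 3]. *)
Lemma tau_inj : injective tau.
Proof.
have /eqP/imset_injP inj : #|[set tau t | t : F * F * F]| = #|{: F * F * F}|.
  by rewrite im_tau card_T !card_prod !expnS expn0 muln1 mulnA.
by move=> s t; apply: inj.
Qed.

Lemma BT_triv : (B :&: T)%g = 1%g.
Proof.
apply/eqP; rewrite trivg_card1; apply/eqP.
have := mul_cardG B T; rewrite D4_mulBT card_B card_T (card_D4 HU) -expnD.
rewrite -[LHS]muln1 => /eqP; rewrite eqn_pmul2l ?expn_gt0 ?q_gt0 //.
by move/eqP.
Qed.

(* Coefficient vectors of linear characters of [B / X_12], with coordinates
   grouped as (3, 11), (8, 9, 10), (5, 6, 7). *)
Definition coefs : finType := ((F * F) * (F * F * F) * (F * F * F))%type.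

(** Label 12 runs past the list, and the default 0 expresses triviality on [X_12]; the entries 0 at
    0, 1, 2, 4 are placeholders for labels outside [B_roots]. *)
Definition coef_at (v : coefs) (j : nat) : F :=
  let: (b3, b11, (b8, b9, b10), (b5, b6, b7)) := v in
  nth 0 [:: 0; 0; 0; b3; 0; b5; b6; b7; b8; b9; b10; b11] j.

Definition char_coefs (f : gT -> algC) : coefs :=
  let b := root_coef f in ((b 3, b 11), (b 8, b 9, b 10), (b 5, b 6, b 7)).

(** The conjuncts say, in this order, that conjugation by [tau t] leaves the coefficients at 8, 9,
    10, 5, 6, 7, 3 unchanged. *)
Definition stabilizes (b : nat -> F) (t : F * F * F) : bool :=
  let: (t1, t2, t4) := t in
  [&& b 11 * t4 == 0, b 11 * t2 == 0, b 11 * t1 == 0,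
      b 8 * t2 + b 9 * t4 + b 11 * t2 * t4 == 0,
      b 8 * t1 + b 10 * t4 + b 11 * t1 * t4 == 0,
      b 9 * t1 + b 10 * t2 + b 11 * t1 * t2 == 0 &
      b 5 * t1 + b 6 * t2 - b 7 * t4 + b 8 * t1 * t2 + b 9 * t1 * t4
        + b 10 * t2 * t4 + b 11 * t1 * t2 * t4 == 0].

Definition nstab (v : coefs) : nat := #|[set t | stabilizes (coef_at v) t]|.

Section InertiaGroup.
Variable f : 'CF(B).
Hypotheses (linf : f \is a linear_char) (f12 : D4rootX x 12 \subset cfker f).
Local Notation b := (coef_at (char_coefs f)).

Lemma fE j u : j \in B_roots -> f (x j u) = phi (b j * u).
Proof.
move=> jB; rewrite root_coefE //; last by move=> t; rewrite mem_root_gen.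
  congr (phi (_ * _)); move: jB; rewrite !inE.
  do 8?[case/predU1P=> [-> //|]] => /eqP->.
  apply/eqP; rewrite -(@sub_cfker_root B f) // => t; exact: mem_root_gen.
by move: j jB; apply/allP.
Qed.

(** Entry [j] collects the coefficients of the higher roots reached from [j] by commutation with
    [tau t]. *)
Definition coef_shift (t : F * F * F) (j : nat) : F :=
  let: (t1, t2, t4) := t in
  nth 0 [:: 0; 0; 0;
    - (b 5 * t1 + b 6 * t2 - b 7 * t4 + b 8 * t1 * t2 + b 9 * t1 * t4
        + b 10 * t2 * t4 + b 11 * t1 * t2 * t4); 0;
    b 8 * t2 + b 9 * t4 + b 11 * t2 * t4;
    b 8 * t1 + b 10 * t4 + b 11 * t1 * t4;
    - (b 9 * t1 + b 10 * t2 + b 11 * t1 * t2);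
    b 11 * t4; b 11 * t2; b 11 * t1] j.

Lemma f_conj_tau t j u : j \in B_roots ->
  f (x j u ^ tau t)%g = phi ((b j + coef_shift t j) * u).
Proof.
case: t => [[t1 t2] t4]; rewrite /tau /=.
rewrite !inE; do 8?[case/predU1P=> [->|]]; last move=> /eqP->;
rewrite !conjgM;
root_conj_simpl HU; rewrite ?(lin_charM linf) ?groupM ?mem_root_gen //;
rewrite !fE // -?phiD; congr (phi _); rewrite /=; ring.
Qed.

Lemma tau_inertia t : (tau t \in 'I[f]) = stabilizes b t.
Proof.
have nB : tau t \in 'N(B).
  apply: subsetP (normal_norm nsBG) _ _.
  by rewrite -D4_mulBT -[tau t]mul1g mem_mulg // -im_tau imset_f.
have shift0 j : j \in B_roots -> tau t \in 'I[f] -> coef_shift t j = 0.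
  move=> jB It; apply: (addrI (b j)); rewrite addr0.
  by apply: phi_mul_inj => u; rewrite -f_conj_tau // inertia_valJ // fE.
apply/idP/idP => [It|st].
  move: (fun j jB => shift0 j jB It); case: (t) => [[t1 t2] t4] sh /=.
  (* The equations for the roots 7 and 3 carry a minus sign in [coef_shift], so they are taken first
     and negated. *)
  apply/and5P; split; [| | | |apply/and3P; split]; apply/eqP; last 2 first.
  - by apply: oppr_inj; rewrite oppr0; apply: (sh 7).
  - by apply: oppr_inj; rewrite oppr0; apply: (sh 3).
  - exact: (sh 8).
  - exact: (sh 9).
  - exact: (sh 10).
  - exact: (sh 5).
  - exact: (sh 6).
apply: mem_inertia_root_gen => // j u jB; rewrite f_conj_tau // fE //.
congr (phi (_ * _)); rewrite -[RHS]addr0; congr (_ + _).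
move: st jB; case: (t) => [[t1 t2] t4] /and5P[] /eqP h1 /eqP h2 /eqP h3 /eqP h4.
move=> /and3P[] /eqP h5 /eqP h6 /eqP h7.
rewrite !inE; do 8?[case/predU1P=> [->|]]; last move=> /eqP->; rewrite /coef_shift.
- exact: (etrans (congr1 -%R h7) (oppr0 _)).
- exact: h4.
- exact: h5.
- exact: (etrans (congr1 -%R h6) (oppr0 _)).
- exact: h1.
- exact: h2.
- exact: h3.
- by [].
- by [].
Qed.

(** Dedekind's modular law, since [B] lies in the inertia group and [B * T] is all of [G]. *)
Lemma inertia_BT : 'I_G[f] = (B * (T :&: 'I_G[f]))%g.
Proof.
rewrite group_modl ?sub_Inertia ?(normal_sub nsBG) // D4_mulBT.
by apply/esym/setIidPr/Inertia_sub.
Qed.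

Lemma index_inertia : (#|G : 'I_G[f]| * nstab (char_coefs f) = q ^ 3)%N.
Proof.
have cI : #|'I_G[f]| = (q ^ 9 * nstab (char_coefs f))%N.
  rewrite {1}inertia_BT TI_cardMg ?card_B; last first.
    by rewrite setIA BT_triv; apply/setIidPl; rewrite sub1G.
  congr (_ * _)%N; rewrite /nstab -(card_imset _ tau_inj); apply: eq_card => g.
  apply/idP/imsetP => [/setIP[Tg /setIP[_ Ig]]|[t + ->]].
    move: Tg Ig; rewrite -im_tau => /imsetP[t _ ->].
    by rewrite tau_inertia => st; exists t; rewrite // inE.
  have Tt : tau t \in T by rewrite -im_tau imset_f.
  rewrite inE -tau_inertia => It; rewrite in_setI Tt in_setI It andbT /=.
  by rewrite -D4_mulBT -[tau t]mul1g mem_mulg.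
have := Lagrange (Inertia_sub G f); rewrite cI (card_D4 HU) => /eqP.
have -> : (q ^ 12 = q ^ 9 * q ^ 3)%N by rewrite -expnD.
rewrite -mulnA eqn_pmul2l ?expn_gt0 ?q_gt0 // mulnC.
by move/eqP.
Qed.

End InertiaGroup.

Lemma irr_B_lin (t : Iirr B) :
  D4rootX x 12 \subset cfker 'chi_t -> 'chi_t \is a linear_char.
Proof.
move=> k12; rewrite lin_irr_der1.
apply: subset_trans (der1_min (normal_norm nsZB) _) _.
  exact: (root_gen_abelian_quotient HU).
by rewrite root_gen_sub_all /= k12.
Qed.

Lemma sub_cfker_coef_at (f : 'CF(B)) j :
    f \is a linear_char -> D4rootX x 12 \subset cfker f -> j \in B_roots ->
  (D4rootX x j \subset cfker f) = (coef_at (char_coefs f) j == 0).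
Proof.
move=> linf f12 jB; have rj : is_root j by move: j jB; apply/allP.
rewrite (@sub_cfker_root B f) // => [|t]; last exact: mem_root_gen.
move: jB; rewrite !inE; do 8?[case/predU1P=> [-> //|]] => /eqP->.
rewrite -(@sub_cfker_root B f) // => [|t]; last exact: mem_root_gen.
by rewrite f12 /= eqxx.
Qed.

(** The squared degrees of these characters add up to [#|B : Z|], and each degree is 1. *)
Lemma card_irr_B : #|[set t : Iirr B | D4rootX x 12 \subset cfker 'chi_t]| = (q ^ 8)%N.
Proof.
have iBZ : #|B : Z| = (q ^ 8)%N.
  have := Lagrange (normal_sub nsZB); rewrite card_B (card_root_gen HU) //= => /eqP.
  have -> : (q ^ 9 = q ^ 1 * q ^ 8)%N by rewrite -expnD.
  by rewrite eqn_pmul2l ?expn_gt0 ?q_gt0 // => /eqP.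
have := sum_square_cfker_sub nsZB; rewrite iBZ => sumB.
apply/eqP; rewrite -(eqr_nat algC) -{}sumB -sum1_card natr_sum; apply/eqP.
apply: eq_big => [t|t]; rewrite inE; first by rewrite root_gen_sub_all /= andbT.
by move=> /irr_B_lin/lin_char1->; rewrite expr1n.
Qed.

(** [char_coefs] is injective because a linear character is determined on generators; both sides
    have [q ^ 8] elements, so every vector occurs. *)
Lemma card_char_coefs (R : pred coefs) :
  #|[pred t : Iirr B | (D4rootX x 12 \subset cfker 'chi_t) &&
                       R (char_coefs 'chi_t)]| = #|R|.
Proof.
pose A := [set t : Iirr B | D4rootX x 12 \subset cfker 'chi_t].
pose c (t : Iirr B) := char_coefs 'chi_t.
have c_inj : {in A &, injective c}.
  move=> s t; rewrite !inE => As At cst; apply: irr_inj.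
  have [ls lt] := (irr_B_lin As, irr_B_lin At).
  apply: lin_char_gen_eq => // a; rewrite inE => /hasP[j jB /imsetP[u _ ->]].
  by rewrite !fE // -/(c s) cst.
have cA : c @: A = setT.
  apply/eqP; rewrite eqEcard subsetT cardsT card_in_imset // card_irr_B.
  by rewrite !card_prod !expnS expn0 muln1 -!mulnA leqnn.
transitivity #|[set t in A | R (c t)]|; first by apply: eq_card => t; rewrite !inE.
rewrite -(@card_in_imset _ _ c) => [|s t]; last first.
  by rewrite !inE => /andP[As _] /andP[At _]; apply: c_inj; rewrite inE.
apply: eq_card => v; apply/imsetP/idP => [[t + ->]|Rv].
  by rewrite inE => /andP[].
have : v \in c @: A by rewrite cA.
by case/imsetP=> t At vE; exists t; rewrite // inE At -vE.
Qed.

Definition in_class (s s' : seq nat) (v : coefs) :=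
  all (fun j => coef_at v j == 0) s && all (fun j => coef_at v j != 0) s'.

Section ClassCount.
Variables s s' : seq nat.
Hypotheses (s12 : 12 \in s) (ns : normal_roots s).
Hypotheses (ns' : all (fun l => normal_roots (l :: s)) s').
Hypotheses (sB : all [in B_roots] s) (s'B : all [in B_roots] s').
Variable P : pred (Iirr G).
Hypothesis defP : P =1 fun i => all (fun j => D4inker x j i) s &&
                               all (fun j => ~~ D4inker x j i) s'.

(** Transfers the kernel conditions that define a class from ['chi_i] to any constituent on [B],
    where they become vanishing conditions on coefficients. *)
Lemma class_constt i t : t \in irr_constt ('Res[B] 'chi_i) ->
  P i = (D4rootX x 12 \subset cfker 'chi_t) && in_class s s' (char_coefs 'chi_t).
Proof.
move=> ti; rewrite defP.
have kerE r : normal_roots r -> all [in B_roots] r ->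
    all (fun j => D4inker x j i) r
      = all (fun j => D4rootX x j \subset cfker 'chi_t) r.
  move=> nr rB; rewrite -!root_gen_sub_all.
  rewrite (sub_cfker_constt_Res nsBG ti) ?root_gen_subset //.
  exact/normal_norm/(root_gen_normal HU).
rewrite kerE //; case: (boolP (_ \subset _)) => [k12 | nk12]; last first.
  by apply/negbTE; apply: contra nk12 => /andP[/allP/(_ 12 s12)].
have lint := irr_B_lin k12.
have cE r : all [in B_roots] r ->
    all (fun j => D4rootX x j \subset cfker 'chi_t) r
      = all (fun j => coef_at (char_coefs 'chi_t) j == 0) r.
  by move=> rB; apply: eq_in_all => j jr; rewrite sub_cfker_coef_at // (allP rB).
rewrite /= /in_class -cE //; case ks: (all _ s) => //=.
apply: eq_in_all => l ls'; congr (~~ _).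
have lB := allP s'B l ls'.
(* [X_l] alone need not be normal in [G], but together with the roots in [s] it generates a normal
   subgroup; as those roots are already in the kernel, the test on [l :: s] is a test on [l]. *)
have := kerE (l :: s) (allP ns' l ls'); rewrite /= lB sB => /(_ isT).
by rewrite kerE // ks !andbT => ->; rewrite sub_cfker_coef_at.
Qed.

Lemma class_irr1 i t : P i -> t \in irr_constt ('Res[B] 'chi_i) ->
  exists2 n, 'chi_i 1%g = n%:R & (n * nstab (char_coefs 'chi_t) = q ^ 3)%N.
Proof.
move=> + ti; rewrite (class_constt ti) => /andP[k12 _].
have lint := irr_B_lin k12; exists #|G : 'I_G['chi_t]|.
  apply: (irr1_abelian_inertia nsBG lint _ (inertia_BT _) ti).
  exact: abelianS (subsetIl _ _) abelian_T.
exact: index_inertia.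
Qed.

Lemma nstab_gt0 v : (0 < nstab v)%N.
Proof.
apply/card_gt0P; exists (0, 0, 0); rewrite inE /=.
by rewrite !(mulr0, mul0r, addr0, subr0, eqxx).
Qed.

(** The degree is [q ^ 3 / nstab] for every constituent, so the condition of having degree [d] also
    passes to [B], and the sum of squares applies to this part of the class alone. *)
Lemma class_ndeg d :
  (D4ndeg P d * d ^ 2
    = #|[pred v | in_class s s' v && (d * nstab v == q ^ 3)]| * q ^ 3)%N.
Proof.
pose S i := P i && ('chi[G]_i 1%g == d%:R).
pose Q (t : Iirr B) := (D4rootX x 12 \subset cfker 'chi_t) &&
  (in_class s s' (char_coefs 'chi_t) && (d * nstab (char_coefs 'chi_t) == q ^ 3)%N).
have SQ i t : t \in irr_constt ('Res[B] 'chi_i) -> S i = Q t.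
  move=> ti; rewrite /S /Q andbA -(class_constt ti); case Pi: (P i) => //=.
  have [n -> <-] := class_irr1 Pi ti.
  by rewrite eqr_nat eqn_pmul2r ?nstab_gt0 // eq_sym.
have linQ t : Q t -> 'chi_t \is a linear_char by case/andP=> /irr_B_lin.
have := sum_square_constt_Res nsBG SQ linQ.
have -> : #|G : B| = (q ^ 3)%N.
  have := Lagrange (normal_sub nsBG); rewrite card_B (card_D4 HU).
  have -> : (q ^ 12 = q ^ 9 * q ^ 3)%N by rewrite -expnD.
  by move/eqP; rewrite eqn_pmul2l ?expn_gt0 ?q_gt0 // => /eqP.
rewrite (_ : #|[pred t | Q t]| =
  #|[pred v | in_class s s' v && (d * nstab v == q ^ 3)%N]|); last first.
  by rewrite -card_char_coefs; apply: eq_card => t; rewrite !inE.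
move=> sumE.
apply/eqP; rewrite -(eqr_nat algC) -{}sumE /D4ndeg natrM natrX -sum1_card natr_sum.
rewrite mulr_suml; apply/eqP; apply: eq_big => [i|i]; first by rewrite inE.
by rewrite inE => /andP[_ /eqP->]; rewrite mul1r.
Qed.

Lemma class_degree i : P i ->
  exists2 v, in_class s s' v &
    exists2 n, 'chi_i 1%g = n%:R & (n * nstab v = q ^ 3)%N.
Proof.
move=> Pi; have /neq0_has_constt[t ti] := Res_irr_neq0 B i.
exists (char_coefs 'chi_t); last exact: class_irr1.
by move: Pi; rewrite (class_constt ti) => /andP[].
Qed.

End ClassCount.

End LinearCoefficients.

(** * Characters nontrivial on the highest root subgroup *)

Section CentralRootNontrivial.
Local Open Scope group_scope.
Local Open Scope ring_scope.
Variables (gT : finGroupType) (F : finFieldType) (G : {group gT}).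
Variable (x : nat -> F -> gT).
Hypothesis HU : D4_unipotent G x.
Variable phi : F -> algC.
Hypothesis phiP : additive_character phi.
Hypothesis phi_nt : exists t, phi t != 1.
Local Notation q := #|F|.
Local Notation T := (root_gen x T_roots).
Local Notation B := (root_gen x B_roots).

Definition A_roots : seq nat := [:: 8; 9; 10; 11; 12]%N.
Local Notation A := (root_gen x A_roots).

Lemma nsAG : (A <| G)%g. Proof. exact: (root_gen_normal HU). Qed.

Lemma irr_A_lin (t : Iirr A) : 'chi_t \is a linear_char.
Proof. by apply/char_abelianP; apply: (root_gen_cent HU). Qed.

(** Representatives of [B] modulo [A]. The roots 3, 5, 6, 7 add up to [alpha_12] with 11, 10, 9, 8
    respectively, so these elements move the coefficients on [A] by multiples of the one at 12. *)
Definition shifter (r : F * F * F * F) : gT :=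
  (x 3 r.1.1.1 * (x 5 r.1.1.2 * (x 6 r.1.2 * x 7 r.2)))%g.

Lemma shifter_in_G r : shifter r \in G.
Proof. by rewrite (D4_gen HU) !groupM ?mem_root_gen. Qed.

Lemma shifter_conj (f : 'CF(A)) j u r : f \is a linear_char -> j \in A_roots ->
  let b := root_coef x phi f in
  f (x j u ^ shifter r)%g =
    phi ((b j + b 12 * nth 0 [:: - r.2; r.1.2; r.1.1.2; r.1.1.1] (j - 8)) * u).
Proof.
move=> linf jA b.
have fE k s : k \in A_roots -> f (x k s) = phi (b k * s).
  move=> kA; apply: (root_coefE HU phiP phi_nt linf).
    by move: k kA; apply/allP.
  by move=> t; apply: mem_root_gen.
move: jA; rewrite !inE; do 4?[case/predU1P=> [->|]]; last move=> /eqP->;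
rewrite /shifter !conjgM; root_conj_simpl HU;
rewrite ?(lin_charM linf) ?groupM ?mem_root_gen // !fE //.
all: rewrite -?(phiD phiP); congr (phi _); rewrite /=; ring.
Qed.

Section Degree.
Variable i : Iirr G.
Hypothesis k12 : ~~ (D4rootX x 12 \subset cfker 'chi_i).

(* The conjugates of a constituent on [A] realise all characters of [A] with
   the same restriction to [X_12]; pick the one trivial on [X_8, .., X_11]. *)
Lemma normalized_constt : exists t : Iirr A,
  [/\ t \in irr_constt ('Res[A] 'chi_i), root_coef x phi 'chi_t 12 != 0
    & forall j, j \in [:: 8; 9; 10; 11]%N -> root_coef x phi 'chi_t j = 0].
Proof.
have /neq0_has_constt[t ti] := Res_irr_neq0 A i.
have lint := irr_A_lin t; set b := root_coef x phi 'chi_t.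
have b12 : b 12 != 0.
  rewrite -(sub_cfker_root HU phiP phi_nt lint) // => [|s]; last first.
    exact: mem_root_gen.
  apply: contra k12 => k.
  have -> : (D4rootX x 12 \subset cfker 'chi_i) =
      (root_gen x [:: 12] \subset cfker 'chi_i) by rewrite root_gen_sub_all /= andbT.
  rewrite -(sub_cfker_constt_Res nsAG ti); first by rewrite root_gen_sub_all /= k.
    exact: root_gen_subset.
  exact/normal_norm/(root_gen_normal HU).
(* Solves [b j + b 12 * (shift at j) = 0] for [j] = 11, 10, 9, 8. *)
pose r := (- b 11 / b 12, - b 10 / b 12, - b 9 / b 12, b 8 / b 12).
pose g := (shifter r)^-1%g.
have Gg : g \in G by rewrite groupV shifter_in_G.
have NAg : g \in 'N(A) := subsetP (normal_norm nsAG) _ Gg.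
have cE j : j \in A_roots -> root_coef x phi 'chi_(conjg_Iirr t g) j =
    b j + b 12 * nth 0 [:: - r.2; r.1.2; r.1.1.2; r.1.1.1] (j - 8).
  move=> jA; have rj : is_root j by move: j jA; apply/allP.
  apply: (phi_mul_inj phiP phi_nt) => u.
  rewrite -(root_coefE HU phiP phi_nt (irr_A_lin _)) // => [|s]; last first.
    exact: mem_root_gen.
  by rewrite conjg_IirrE cfConjgE // invgK shifter_conj.
exists (conjg_Iirr t g); split.
- rewrite irr_consttE conjg_IirrE cfdot_Res_conjg // -irr_consttE //.
- by rewrite cE //= mulr0 addr0.
move=> j; rewrite !inE; do 3?[case/predU1P=> [->|]]; last move=> /eqP->;
by rewrite cE //=; field.
Qed.

Lemma irr1_X12 : 'chi_i 1%g = (q ^ 4)%:R.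
Proof.
have [t [ti b12 b0]] := normalized_constt.
have lint := irr_A_lin t; set b := root_coef x phi 'chi_t in b12 b0.
have fE k s : k \in A_roots -> 'chi_t (x k s) = phi (b k * s).
  move=> kA; apply: (root_coefE HU phiP phi_nt lint).
    by move: k kA; apply/allP.
  by move=> u; apply: mem_root_gen.
have sTG : T \subset G by rewrite (D4_gen HU) root_gen_subset.
have sTI : T \subset 'I_G['chi_t].
  apply/root_gen_subP => k s kT.
  have Gk : x k s \in G by rewrite (subsetP sTG) ?mem_root_gen.
  rewrite inE Gk; apply: mem_inertia_root_gen => // [|j u].
    exact: (subsetP (normal_norm nsAG)).
  (* From [A], commutators with [X_1], [X_2], [X_4] lead only into [X_11], where ['chi_t] is
     trivial. *)
  move: kT; rewrite !inE; do 2?[case/predU1P=> [->|]]; last move=> /eqP->;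
  do 4?[case/predU1P=> [->|]]; try (move=> /eqP->); root_conj_simpl HU => //;
  by rewrite (lin_charM lint) ?mem_root_gen // !fE // (b0 11) // !mul0r -(phiD phiP) addr0.
have defI : 'I_G['chi_t] = (A * T)%g.
  apply/eqP; rewrite eqEsubset mul_subG ?sTI ?sub_Inertia ?(normal_sub nsAG) //.
  rewrite andbT; apply/subsetP => y Iy.
  have : y \in (B * T)%g by rewrite (D4_mulBT HU); case/setIP: Iy.
  case/mulsgP=> c z Bc Tz def_y.
  have [r3 [c1 Bc1 def_c]] :=
    root_gen_cons HU (j := 3) (s := drop 1 B_roots) isT isT isT Bc.
  have [r5 [c2 Bc2 def_c1]] :=
    root_gen_cons HU (j := 5) (s := drop 2 B_roots) isT isT isT Bc1.
  have [r6 [c3 Bc3 def_c2]] :=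
    root_gen_cons HU (j := 6) (s := drop 3 B_roots) isT isT isT Bc2.
  have [r7 [a Aa def_c3]] :=
    root_gen_cons HU (j := 7) (s := A_roots) isT isT isT Bc3.
  have {}def_c : c = (shifter (r3, r5, r6, r7) * a)%g.
    by rewrite def_c def_c1 def_c2 def_c3 /shifter /= !mulgA.
  suffices s1 : shifter (r3, r5, r6, r7) = 1%g.
    by rewrite def_y def_c s1 mul1g mem_mulg.
  have Ia : a \in 'I_G['chi_t].
    by apply: subsetP Aa; rewrite sub_Inertia ?(normal_sub nsAG).
  have Iz : z \in 'I_G['chi_t] by apply: (subsetP sTI).
  have : shifter (r3, r5, r6, r7) \in 'I_G['chi_t].
    by rewrite -(groupMr _ Ia) -(groupMr _ Iz) -def_c -def_y.
  case/setIP=> _ Ish.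
  (* An inertial shifter must leave the coefficients at 8, 9, 10, 11 fixed; as [b 12] is nonzero,
     its four parameters vanish. *)
  have z0 j : j \in A_roots ->
      nth 0 [:: - r7; r6; r5; r3] (j - 8) = 0.
    move=> jA; apply: (mulfI b12); rewrite mulr0.
    apply: (addrI (b j)); rewrite addr0; apply: (phi_mul_inj phiP phi_nt) => u.
    by rewrite -fE // -(inertia_valJ (x j u) Ish) shifter_conj.
  have /= r30 := z0 11 isT; have /= r50 := z0 10 isT; have /= r60 := z0 9 isT.
  have /= /eqP := z0 8 isT; rewrite oppr_eq0 => /eqP r70.
  by rewrite /shifter /= r30 r50 r60 r70 !(root_elt0 HU) // !mulg1.
rewrite (irr1_abelian_inertia nsAG lint (abelian_T HU) defI ti).
have cI : #|'I_G['chi_t]| = (q ^ 8)%N.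
  rewrite defI TI_cardMg ?(card_root_gen HU) // -?expnD //.
  apply/trivgP; rewrite -(BT_triv HU) setSI //.
  exact: root_gen_subset.
congr _%:R; have := Lagrange (Inertia_sub G 'chi_t).
rewrite cI (card_D4 HU) => /eqP.
have -> : (q ^ 12 = q ^ 8 * q ^ 4)%N by rewrite -expnD.
by rewrite eqn_pmul2l ?expn_gt0 ?q_gt0 // => /eqP.
Qed.

End Degree.

Lemma ndeg_X12 :
  D4ndeg (fun i : Iirr G => ~~ D4inker x 12 i) (q ^ 4) = (q ^ 3 * (q - 1))%N.
Proof.
have nsZG : (root_gen x [:: 12] <| G)%g by exact: (root_gen_normal HU).
have iGZ : #|G : root_gen x [:: 12]| = (q ^ 11)%N.
  have := Lagrange (normal_sub nsZG); rewrite (card_D4 HU) (card_root_gen HU) //= => /eqP.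
  have -> : (q ^ 12 = q ^ 1 * q ^ 11)%N by rewrite -expnD.
  by rewrite eqn_pmul2l ?expn_gt0 ?q_gt0 // => /eqP.
have := irr_sum_square G.
rewrite (bigID (fun i => root_gen x [:: 12] \subset cfker 'chi_i)) /=.
rewrite (sum_square_cfker_sub nsZG) iGZ (card_D4 HU).
set n := D4ndeg _ _.
have -> : \sum_(i | ~~ (root_gen x [:: 12] \subset cfker 'chi[G]_i)) 'chi_i 1%g ^+ 2
    = (n * q ^ 8)%:R.
  rewrite natrM /n /D4ndeg -sum1_card natr_sum mulr_suml; apply: eq_big => [i|i].
    rewrite inE root_gen_sub_all /= andbT /D4inker.
    by case: (boolP (_ \subset _)) => // k; rewrite /= irr1_X12 // eqxx.
  rewrite root_gen_sub_all /= andbT => k.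
  by rewrite irr1_X12 // mul1r -natrX -expnM.
rewrite -natrD => /eqP; rewrite eqr_nat.
(* The characters trivial on [X_12] account for [q ^ 11] of the order; the remaining squares all
   equal [q ^ 8]. *)
have -> : (q ^ 12 = q ^ 11 + (q ^ 3 * (q - 1)) * q ^ 8)%N.
  have := q_gt0 F; case: (q) => // m _.
  by rewrite subSS subn0 mulnAC -expnD /= expnS mulSn mulnC.
by rewrite eqn_add2l eqn_pmul2r ?expn_gt0 ?q_gt0 // => /eqP.
Qed.

End CentralRootNontrivial.

(** * Counting coefficient vectors *)

Section Counting.
Local Open Scope ring_scope.
Variable F : finFieldType.
Local Notation q := #|F|.
Local Notation F3 := (F * F * F)%type.

Lemma q_gt1 : (1 < q)%N.
Proof.
rewrite (cardD1 0) (cardD1 1) !inE oner_neq0 //.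
Qed.

Lemma card_nz : #|[pred b : F | b != 0]| = (q - 1)%N.
Proof.
rewrite (cardD1 0 F) inE add1n subSS subn0.
by apply: eq_card => b; rewrite !inE andbT.
Qed.

Lemma card_F3 (P1 P2 P3 : pred F) :
  #|[pred w : F3 | [&& P1 w.1.1, P2 w.1.2 & P3 w.2]]| = (#|P1| * #|P2| * #|P3|)%N.
Proof.
rewrite -!cardX; apply: eq_card => [[[u v] w]].
by rewrite !inE /= andbA.
Qed.

Definition dotp (w d : F3) : F := w.1.1 * d.1.1 + w.1.2 * d.1.2 + w.2 * d.2.

(** Translating by [c] times a vector of value 1 identifies the fibre over 0 with the fibre over
    [c], so the [q] fibres share [q ^ 3] vectors evenly. *)
Lemma card_dotp_eq0 d : d != (0, 0, 0) ->
  #|[pred w | dotp w d == 0]| = (q ^ 2)%N.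
Proof.
move=> nz; have [w0 w01] : exists w0, dotp w0 d = 1.
  case: d nz => [[d1 d2] d3] nz; rewrite /dotp /=.
  have [d10|n1] := eqVneq d1 0; last first.
    by exists (d1^-1, 0, 0); rewrite /= mulVf // !mul0r !addr0.
  have [d20|n2] := eqVneq d2 0; last first.
    by exists (0, d2^-1, 0); rewrite /= mulVf // !mul0r addr0 add0r.
  have [d30|n3] := eqVneq d3 0; last first.
    by exists (0, 0, d3^-1); rewrite /= mulVf // !mul0r !add0r.
  by move: nz; rewrite d10 d20 d30 eqxx.
have fib c : #|[pred w | dotp w d == c]| = #|[pred w | dotp w d == 0]|.
  pose h (w : F3) : F3 := (w.1.1 + c * w0.1.1, w.1.2 + c * w0.1.2, w.2 + c * w0.2).
  have h_inj : injective h.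
    by move=> [[u1 u2] u3] [[v1 v2] v3] [/addIr-> /addIr-> /addIr->].
  rewrite -[RHS](card_imset _ h_inj); apply: eq_card => w.
  have dE u : dotp (h u) d = dotp u d + c.
    by rewrite -[X in _ = _ + X]mulr1 -w01 /dotp /=; ring.
  apply/idP/imsetP => [wc|[u u0 ->]]; last first.
    by move: u0; rewrite !inE dE => /eqP->; rewrite add0r.
  exists (w.1.1 - c * w0.1.1, w.1.2 - c * w0.1.2, w.2 - c * w0.2).
    rewrite inE; apply/eqP/(addIr c); rewrite -dE add0r; apply/eqP.
    by move: wc; rewrite inE /h /= !subrK; case: (w) => [[]].
  by rewrite /h /= !subrK; case: (w) => [[]].
have : #|{: F3}| = (\sum_(c : F) #|[pred w | dotp w d == c]|)%N.
  rewrite -sum1_card (partition_big (fun w => dotp w d) xpredT) //=.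
  by apply: eq_bigr => c _; rewrite -sum1_card; apply: eq_bigl => w; rewrite inE.
rewrite (eq_bigr _ (fun c _ => fib c)) sum_nat_const !card_prod => /eqP.
rewrite -mulnA eqn_pmul2l; last exact: ltnW q_gt1.
by rewrite mulnn => /eqP.
Qed.

Lemma card_dotp_neq0 d : d != (0, 0, 0) ->
  #|[pred w | dotp w d != 0]| = (q ^ 2 * (q - 1))%N.
Proof.
move=> nz; have := cardC [pred w | dotp w d == 0].
rewrite card_dotp_eq0 // !card_prod.
rewrite (eq_card (B := [pred w | dotp w d != 0])) // => e.
apply/eqP; rewrite -(eqn_add2l (q ^ 2)) e.
have := q_gt1; case: (q) => // m _; rewrite subSS subn0.
by apply/eqP; ring.
Qed.

Lemma card_coefs (P1 : pred (F * F)) (P2 : pred F3) (P3 : F3 -> pred F3) n :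
    (forall b, P2 b -> #|P3 b| = n) ->
  #|[pred v : coefs F | [&& P1 v.1.1, P2 v.1.2 & P3 v.1.2 v.2]]|
    = (#|P1| * #|P2| * n)%N.
Proof.
move=> cP3; rewrite -mulnA -sum1_card.
rewrite (eq_bigl (fun v : coefs F => (P1 v.1.1 && P2 v.1.2) && P3 v.1.2 v.2)); last first.
  by move=> v; rewrite !inE andbA.
rewrite -(pair_big_dep (fun u : F * F * F3 => P1 u.1 && P2 u.2)
           (fun u w => P3 u.2 w) (fun _ _ => 1%N)) /=.
rewrite (eq_bigr (fun=> n)) => [|u /andP[_ /cP3 <-]]; last by rewrite sum1_card.
rewrite sum_nat_const mulnA -cardX; congr (_ * n)%N.
Qed.

(** If 2 vanishes in [F], then 1 has additive order 2, which divides [q]; conversely Cauchy's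
    theorem gives a nonzero [y] with [y + y = 0]. *)
Lemma odd_card_field : odd q = (2%:R != 0 :> F).
Proof.
apply/idP/idP => [oq|].
  apply: contraTneq oq => F2; rewrite -dvdn2.
  have o1 : #[1%R : F]%g = 2%N.
    by apply: nt_prime_order => //; apply: oner_neq0.
  by rewrite -o1 -cardsT order_dvdG // inE.
apply: contraNT; rewrite -dvdn2 -cardsT => d2.
have [y _ oy] := Cauchy (G := [set: F]%G) (isT : prime 2) d2.
have y0 : y != 0 by apply: contra_eq_neq oy => ->; rewrite order1.
apply/eqP/(mulIf y0); rewrite mul0r mulr_natl.
by have := expg_order y; rewrite oy.
Qed.

End Counting.

(** * Stabilizer orders as functions of the coefficient vector *)

Section StabilizerOrders.
Local Open Scope ring_scope.
Variable F : finFieldType.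
Local Notation q := #|F|.
Local Notation F3 := (F * F * F)%type.
Implicit Types (b w : F3) (u : F * F).

(** For [b11 = 0] the equations of the roots 5, 6, 7 are the partial derivatives of the quadratic
    form [b8 t1 t2 + b9 t1 t4 + b10 t2 t4], and their matrix has determinant [2 * mulcoef b]. *)
Definition mulcoef b : F := b.1.1 * b.1.2 * b.2.

(* When [2 * b8 * b9 * b10 = 0] and [(b8, b9, b10) != 0], the equations of
   [stabilizes] coming from the roots 5, 6, 7 cut out the line spanned by
   [(d.1.1, d.1.2, - d.2)], where [d] is this vector. *)
Definition stab_dir b : F3 :=
  if b.1.1 != 0 then (- b.2, - b.1.2, - b.1.1) else (b.2, - b.1.2, 0).

Lemma stab_dir_neq0 b : b != (0, 0, 0) -> stab_dir b != (0, 0, 0).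
Proof.
case: b => [[b8 b9] b10]; rewrite /stab_dir /= !xpair_eqE.
case: (eqVneq b8 0) => [->|n8] /=; rewrite !xpair_eqE !oppr_eq0.
  by rewrite eqxx andbT andbC.
by rewrite (negPf n8) andbF.
Qed.

Lemma nstab_X11 u b w : u.2 != 0 -> nstab (u, b, w) = 1%N.
Proof.
case: u b w => [b3 b11] [[b8 b9] b10] [[b5 b6] b7] /= nz.
rewrite /nstab (_ : [set t | _] = [set (0, 0, 0)]) ?cards1 //.
apply/setP => [[[t1 t2] t4]]; rewrite !inE /= !mulf_eq0 (negPf nz) /=.
apply/idP/eqP => [/and4P[/eqP-> /eqP-> /eqP-> _] //|[-> -> ->]].
by rewrite !(mulr0, addr0, subr0, eqxx).
Qed.

Lemma nstab_odd (b3 : F) b w : 2%:R != 0 :> F -> mulcoef b != 0 ->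
  nstab (b3, 0, b, w) = 1%N.
Proof.
case: b w => [[b8 b9] b10] [[b5 b6] b7] n2.
rewrite /mulcoef /= !mulf_eq0 !negb_or => /andP[/andP[n8 n9] n10].
rewrite /nstab (_ : [set t | _] = [set (0, 0, 0)]) ?cards1 //.
apply/setP => [[[t1 t2] t4]]; rewrite !inE /=.
apply/idP/eqP => [|[-> -> ->]]; last by rewrite !(mulr0, addr0, subr0, eqxx).
rewrite !mul0r !addr0 eqxx /= => /and4P[/eqP h5 /eqP h6 /eqP h7 _].
have t40 : t4 = 0.
  (* The combination of the three linear equations below eliminates [t1] and [t2] and leaves
     [2 b9 b10 t4]. *)
  apply: (mulfI (mulf_neq0 n2 (mulf_neq0 n9 n10))); rewrite mulr0.
  transitivity (b10 * (b8 * t2 + b9 * t4) + b9 * (b8 * t1 + b10 * t4)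
                - b8 * (b9 * t1 + b10 * t2)); first by ring.
  by rewrite h5 h6 h7; ring.
move: h5 h6; rewrite t40 !mulr0 !addr0 => /eqP + /eqP.
by rewrite !mulf_eq0 (negPf n8) /= => /eqP-> /eqP->.
Qed.

(** With vanishing determinant the three linear equations define a line; the equation of the root 3,
    restricted to it, is the displayed quadratic in the parameter [s]. *)
Lemma nstab_line (b3 : F) b w : b != (0, 0, 0) -> 2%:R * mulcoef b = 0 ->
  nstab (b3, 0, b, w)
    = #|[pred s : F | s * (dotp w (stab_dir b) - s * mulcoef b) == 0]|.
Proof.
case: b w => [[b8 b9] b10] [[b5 b6] b7] nz two; set d := stab_dir _.
(* The sign on the third coordinate absorbs the minus of [- b7 * t4], so that the linear part
   becomes [dotp w d]. *)
pose l (s : F) : F3 := (s * d.1.1, s * d.1.2, - (s * d.2)).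
have dnz : d != (0, 0, 0) by apply: stab_dir_neq0.
have l_inj : injective l.
  move=> s t [e1 e2 e3]; have [d1|n] := eqVneq d.1.1 0; last exact: mulIf e1.
  have [d2|n] := eqVneq d.1.2 0; last exact: mulIf e2.
  have [d3|n] := eqVneq d.2 0; last exact/(mulIf n)/oppr_inj.
  have dE : d = (d.1.1, d.1.2, d.2) by case: (d) => [[]].
  by move: dnz; rewrite dE d1 d2 d3 eqxx.
rewrite /nstab -(card_imset _ l_inj); apply: eq_card => [[[t1 t2] t4]].
have lin_d : [/\ b8 * d.1.2 - b9 * d.2 = 0, b8 * d.1.1 - b10 * d.2 = 0
               & b9 * d.1.1 + b10 * d.1.2 = 0].
  rewrite /d /stab_dir /=; case: (eqVneq b8 0) => [->|n8] /=; split; try ring.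
  (* This is where [two] enters: for nonzero [b8], the third equation at [d], multiplied by [b8], is
     [- 2 * mulcoef b]. *)
  apply: (mulfI n8); rewrite mulr0 -oppr0 -two /mulcoef /=; ring.
have quad_d : b8 * d.1.1 * d.1.2 - b9 * d.1.1 * d.2 - b10 * d.1.2 * d.2
    = - mulcoef (b8, b9, b10).
  by rewrite /d /stab_dir /mulcoef /=; case: (eqVneq b8 0) => [->|n8] /=; ring.
rewrite inE /= !mul0r !addr0 eqxx /=.
have eq3 s : b5 * (s * d.1.1) + b6 * (s * d.1.2) - b7 * - (s * d.2)
    + b8 * (s * d.1.1) * (s * d.1.2) + b9 * (s * d.1.1) * - (s * d.2)
    + b10 * (s * d.1.2) * - (s * d.2)
    = s * (dotp (b5, b6, b7) d - s * mulcoef (b8, b9, b10)).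
  rewrite -[in RHS]mulrN -quad_d /dotp /=; ring.
apply/idP/imsetP => [/and4P[/eqP h5 /eqP h6 /eqP h7 /eqP h3]|[s s0 [-> -> ->]]].
  (* The parameter is read off a coordinate where the direction is nonzero: [t4] if [b8] is nonzero,
     otherwise [t2] if [b9] is, otherwise [t1]. *)
  have [s [e1 e2 e4]] : exists s, [/\ t1 = s * d.1.1, t2 = s * d.1.2 & t4 = - (s * d.2)].
    move: nz; rewrite /d /stab_dir /=; case: (eqVneq b8 0) => [b80|n8] /= nz.
      move: h5 h6 h7 nz; rewrite b80 !mul0r !add0r !xpair_eqE eqxx /=.
      move=> h5 h6 h7; have [b90|n9] := eqVneq b9 0 => /= [n10|_].
        exists (t1 / b10); move: h6 h7; rewrite b90 mul0r add0r => /eqP h6 /eqP h7.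
        move: h6 h7; rewrite !mulf_eq0 (negPf n10) /= => /eqP-> /eqP->.
        by rewrite divfK // !(mulr0, oppr0).
      move/eqP: h5; rewrite mulf_eq0 (negPf n9) /= => /eqP->.
      exists (- t2 / b9); rewrite mulr0 oppr0 mulNr mulrNN divfK //.
      split=> //; apply: (mulfI n9); apply/eqP; rewrite -subr_eq0 -{}h7; apply/eqP.
      by field.
    exists (t4 / b8); split.
    - apply: (mulfI n8); apply/eqP; rewrite -subr_eq0 -h6; apply/eqP; by field.
    - apply: (mulfI n8); apply/eqP; rewrite -subr_eq0 -h5; apply/eqP; by field.
    - by rewrite mulrN opprK divfK.
  exists s; last by rewrite /l e1 e2 e4.
  by rewrite inE -eq3 -e1 -e2 -e4 h3.
have [l5 l6 l7] := lin_d; rewrite inE -eq3 in s0.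
apply/and4P; split=> //; apply/eqP.
- by rewrite -[RHS](mulr0 s) -l5; ring.
- by rewrite -[RHS](mulr0 s) -l6; ring.
- by rewrite -[RHS](mulr0 s) -l7; ring.
Qed.

Lemma nstab_mixed (b3 : F) b w : b != (0, 0, 0) -> mulcoef b = 0 ->
  nstab (b3, 0, b, w) = if dotp w (stab_dir b) == 0 then q else 1%N.
Proof.
move=> nz m0; rewrite nstab_line ?m0 ?mulr0 //; case: ifP => [/eqP d0|/negP/negP dn].
  by apply: eq_card => s; rewrite !inE d0 mulr0 subr0 mulr0 eqxx.
rewrite -(card1 (0 : F)); apply: eq_card => s.
by rewrite !inE mulr0 subr0 mulf_eq0 (negPf dn) orbF.
Qed.

(** The quadratic has the roots 0 and [dotp w (stab_dir b) / mulcoef b], which coincide exactly when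
    the linear part vanishes. *)
Lemma nstab_even (b3 : F) b w : 2%:R = 0 :> F -> mulcoef b != 0 ->
  nstab (b3, 0, b, w) = if dotp w (stab_dir b) == 0 then 1%N else 2.
Proof.
move=> F2 mn; rewrite nstab_line ?F2 ?mul0r //; last first.
  by apply: contraNneq mn => ->; rewrite /mulcoef /= !mulr0.
set c := dotp _ _; have sE s : (s * (c - s * mulcoef b) == 0)
    = (s == 0) || (s == c / mulcoef b).
  by rewrite mulf_eq0 subr_eq0 eq_sym -[s == c / _](inj_eq (mulIf mn)) divfK // [_ == c]eq_sym.
case: eqVneq => [c0|cn].
  rewrite -(card1 (0 : F)); apply: eq_card => s.
  by rewrite !inE sE c0 mul0r orbb.
have dn : 0 != c / mulcoef b by rewrite eq_sym mulf_neq0 ?invr_eq0.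
transitivity #|[set 0; c / mulcoef b]|; last by rewrite cards2 dn.
apply: eq_card => s.
by rewrite !inE sE.
Qed.

Lemma nstab_X567 (b3 : F) w : w != (0, 0, 0) -> nstab (b3, 0, (0, 0, 0), w) = (q ^ 2)%N.
Proof.
case: w => [[b5 b6] b7] nz; rewrite -(@card_dotp_eq0 _ (b5, b6, - b7)).
  rewrite /nstab; apply: eq_card => [[[t1 t2] t4]].
  by rewrite !inE /= !mul0r !addr0 eqxx /= /dotp /= mulrN ![_ * b5]mulrC [_ * b6]mulrC [_ * b7]mulrC.
by move: nz; rewrite !xpair_eqE oppr_eq0.
Qed.

Lemma nstab_linear (b3 : F) : nstab (b3, 0, (0, 0, 0), (0, 0, 0)) = (q ^ 3)%N.
Proof.
rewrite /nstab (_ : [set t | _] = setT) ?cardsT ?card_prod ?expnS ?expn0 ?muln1 ?mulnA //.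
by apply/setP => [[[t1 t2] t4]]; rewrite !inE /= !mul0r !addr0 subr0 eqxx.
Qed.

End StabilizerOrders.

(** * The families *)

(** Bundles the side conditions of the class count into one boolean that evaluates to true for each
    family. Label 12 is kept out of [s'] because the coefficient at 12 is always 0 here. *)
Definition class_ok (s s' : seq nat) :=
  [&& 12 \in s, normal_roots s, all (fun l => normal_roots (l :: s)) s',
      all [in B_roots] s & all [in B_roots] s' && (12 \notin s')].

Section Families.
Variables (gT : finGroupType) (F : finFieldType) (G : {group gT}).
Variable (x : nat -> F -> gT).
Hypothesis HU : D4_unipotent G x.
Variable phi : F -> algC.
Hypothesis phiP : additive_character phi.
Hypothesis phi_nt : exists t, phi t != 1%R.
Local Notation q := #|F|.

Section Class.
Variables s s' : seq nat.
Hypothesis okss' : class_ok s s'.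

Definition zero_pattern (j : nat) : pred F :=
  fun b => ((j \in s) ==> (b == 0%R)) && ((j \in s') ==> (b != 0%R)).

Definition npattern (j : nat) : nat :=
  if j \in s then (if j \in s' then 0 else 1) else if j \in s' then q - 1 else q.

Lemma card_zero_pattern j : #|zero_pattern j| = npattern j.
Proof.
rewrite /npattern /zero_pattern; case: (j \in s); case: (j \in s') => /=.
- by apply: eq_card0 => b; rewrite unfold_in /= andbN.
- by rewrite -(card1 (0%R : F)); apply: eq_card => b; rewrite -!topredE /= ?andbT.
- by rewrite -card_nz.
- exact: eq_card.
Qed.

Definition pattern3 (j k l : nat) : pred (F * F * F) :=
  fun w => [&& zero_pattern j w.1.1, zero_pattern k w.1.2 & zero_pattern l w.2].

Definition pattern2 : pred (F * F) :=
  fun u => zero_pattern 3 u.1 && zero_pattern 11 u.2.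

Lemma card_pattern3 j k l :
  #|pattern3 j k l| = npattern j * npattern k * npattern l.
Proof. by rewrite -!card_zero_pattern -card_F3. Qed.

Lemma card_pattern2 : #|pattern2| = npattern 3 * npattern 11.
Proof. by rewrite -!card_zero_pattern -cardX. Qed.

Lemma in_classE (v : coefs F) : in_class s s' v =
  [&& pattern2 v.1.1, pattern3 8 9 10 v.1.2 & pattern3 5 6 7 v.2].
Proof.
case/and5P: okss' => s12 _ _ sB /andP[s'B n12].
have allB r (a : pred nat) : all [in B_roots] r ->
    all a r = all (fun j => (j \in r) ==> a j) B_roots.
  move=> rB; apply/allP/allP => [ar j _|aB j jr]; first by apply/implyP/ar.
  by have := aB j (allP rB j jr); rewrite jr.
rewrite /in_class (allB s) // (allB s') // /pattern2 /pattern3 /zero_pattern.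
case: v => [[[b3 b11] [[b8 b9] b10]] [[b5 b6] b7]] /=.
rewrite eqxx implybT (negPf n12) /= !andbT.
by apply/idP/idP => [/andP[] /and5P[-> -> -> -> /and4P[-> -> -> ->]]
  /and5P[-> -> -> -> /and4P[-> -> -> ->]]
  |/and3P[/andP[/andP[-> ->] /andP[-> ->]] /and3P[/andP[-> ->] /andP[-> ->] /andP[-> ->]]
    /and3P[/andP[-> ->] /andP[-> ->] /andP[-> ->]]]].
Qed.

Section Counts.
Variable P : pred (Iirr G).
Hypothesis defP : P =1 fun i => all (fun j => D4inker x j i) s &&
                               all (fun j => ~~ D4inker x j i) s'.

(** For classes on which the stabilizer order varies: [P3] selects the vectors at 5, 6, 7 giving
    degree [d], and their number does not depend on the admissible coefficients at 8, 9, 10. *)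
Lemma class_count d (P3 : F * F * F -> pred (F * F * F)) n :
    (forall v : coefs F, in_class s s' v ->
      (d * nstab v == q ^ 3) = P3 v.1.2 v.2) ->
    ~~ has [in s ++ s'] [:: 5; 6; 7] ->
    (forall b, pattern3 8 9 10 b -> #|P3 b| = n) ->
  D4ndeg P d * d ^ 2 =
    npattern 3 * npattern 11 * (npattern 8 * npattern 9 * npattern 10) * n * q ^ 3.
Proof.
move=> dE free cP3; case/and5P: okss' => s12 ns ns' sB /andP[s'B _].
rewrite (class_ndeg HU phiP phi_nt s12 ns ns' sB s'B defP); congr (_ * _).
rewrite -card_pattern2 -card_pattern3 -(@card_coefs _ _ _ P3) //.
have p567 w : pattern3 5 6 7 w.
  by move: free; rewrite /= !negb_or !mem_cat !negb_or /pattern3 /zero_pattern => /and4P[/andP[/negPf-> /negPf->] /andP[/negPf-> /negPf->] /andP[/negPf-> /negPf->] _].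
apply: eq_card => v; rewrite !inE; case: (boolP (in_class s s' v)) => /= [cv|].
  by rewrite dE //; move: cv; rewrite in_classE => /and3P[-> -> _].
by rewrite in_classE p567 andbT => /negPf; case: pattern2 => //= ->.
Qed.

Lemma class_single d m N :
    (forall v : coefs F, in_class s s' v -> nstab v = m) -> d * m = q ^ 3 ->
    N * d ^ 2 = npattern 3 * npattern 11 * (npattern 8 * npattern 9 * npattern 10)
      * (npattern 5 * npattern 6 * npattern 7) * q ^ 3 ->
  D4ndeg P d = N /\ D4degs_in P [:: d].
Proof.
move=> cm dm defN; case/and5P: okss' => s12 ns ns' sB /andP[s'B _].
have /andP[d_gt0 m_gt0] : (0 < d) && (0 < m).
  by rewrite -muln_gt0 dm expn_gt0 (ltnW (q_gt1 F)).
split=> [|i /(class_degree HU phiP phi_nt s12 ns ns' sB s'B defP)[v /cm mE [n -> nm]]].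
  apply/eqP; rewrite -(eqn_pmul2r (m := d ^ 2)) ?expn_gt0 ?d_gt0 // defN.
  rewrite (class_ndeg HU phiP phi_nt s12 ns ns' sB s'B defP); apply/eqP; congr (_ * _).
  rewrite -card_pattern2 -!card_pattern3 -(@card_coefs _ _ _ (fun=> pattern3 5 6 7)) //.
  apply: eq_card => v; rewrite !inE -in_classE; case: (boolP (in_class s s' v)) => //= /cm->.
  by rewrite dm eqxx.
exists d; first by rewrite inE.
by congr (_%:R)%R; apply/eqP; rewrite -(eqn_pmul2r m_gt0) dm -mE nm.
Qed.

Lemma in_class_X11 (v : coefs F) : 11 \in s -> in_class s s' v -> v.1.1.2 = 0%R.
Proof.
move=> s11 /andP[/allP/(_ 11 s11) + _].
by case: v => [[[b3 b11] [[b8 b9] b10]] [[b5 b6] b7]] /= /eqP.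
Qed.

(** Here the quadratic degenerates to [s * dotp w d = 0]. The [q ^ 2] vectors [w] orthogonal to [d]
    have stabilizer order [q] and degree [q ^ 2]; the others have trivial stabilizer and degree
    [q ^ 3]. *)
Lemma class_mixed :
    11 \in s -> npattern 11 = 1 -> npattern 3 = q ->
    ~~ has [in s ++ s'] [:: 5; 6; 7] ->
    (forall b, pattern3 8 9 10 b -> b != (0, 0, 0)%R /\ mulcoef b = 0%R) ->
  let N := npattern 8 * npattern 9 * npattern 10 in
  [/\ D4ndeg P (q ^ 3) = N * (q - 1), D4ndeg P (q ^ 2) = q ^ 2 * N
    & D4degs_in P [:: q ^ 3; q ^ 2]].
Proof.
move=> s11 n11 n3 free mixed N; have q1 := q_gt1 F; have q0 := ltnW q1.
have nstabE (v : coefs F) : in_class s s' v ->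
    nstab v = if dotp v.2 (stab_dir v.1.2) == 0%R then q else 1.
  move=> cv; have v11 := in_class_X11 s11 cv; move: cv; rewrite in_classE.
  case: v v11 => [[[b3 b11] b] w] /= -> /and3P[_ /mixed[nz m0] _].
  exact: nstab_mixed.
split.
- have := @class_count (q ^ 3) (fun b w => dotp w (stab_dir b) != 0%R)
    (q ^ 2 * (q - 1)) _ free _.
  rewrite n11 n3 -/N => e; apply/eqP; rewrite -(eqn_pmul2r (m := (q ^ 3) ^ 2)).
    rewrite e => [|v cv|b /mixed[nz _]].
    + by apply/eqP; ring.
    + rewrite nstabE // -{2}[q ^ 3]muln1 eqn_pmul2l ?expn_gt0 ?q0 //.
      by case: ifP => // _; apply/negbTE; rewrite neq_ltn q1 orbT.
    + exact: card_dotp_neq0 (stab_dir_neq0 nz).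
  by rewrite !expn_gt0 q0.
- have := @class_count (q ^ 2) (fun b w => dotp w (stab_dir b) == 0%R)
    (q ^ 2) _ free _.
  rewrite n11 n3 -/N => e; apply/eqP; rewrite -(eqn_pmul2r (m := (q ^ 2) ^ 2)).
    rewrite e => [|v cv|b /mixed[nz _]].
    + by apply/eqP; ring.
    + rewrite nstabE // (expnSr q 2) eqn_pmul2l ?expn_gt0 ?q0 //.
      by case: ifP => // _; rewrite ?eqxx //; apply/negbTE; rewrite neq_ltn q1.
    + exact: card_dotp_eq0 (stab_dir_neq0 nz).
  by rewrite !expn_gt0 q0.
move=> i Pi; case/and5P: okss' => s12 ns ns' sB /andP[s'B _].
have [v cv [n ->]] := class_degree HU phiP phi_nt s12 ns ns' sB s'B defP Pi.
rewrite nstabE //; case: ifP => _ nE.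
  exists (q ^ 2); first by rewrite !inE eqxx orbT.
  by congr (_%:R)%R; apply/eqP; rewrite -(eqn_pmul2r q0) nE (expnSr q 2).
by exists (q ^ 3); rewrite ?inE ?eqxx // -nE muln1.
Qed.

Lemma class_even : 2%:R%R = 0%R :> F ->
    11 \in s -> npattern 11 = 1 -> npattern 3 = q ->
    ~~ has [in s ++ s'] [:: 5; 6; 7] ->
    (forall b, pattern3 8 9 10 b -> mulcoef b != 0%R) ->
  let N := npattern 8 * npattern 9 * npattern 10 in
  [/\ D4ndeg P (q ^ 3) = N, D4ndeg P (q ^ 3 %/ 2) = 4 * N * (q - 1)
    & D4degs_in P [:: q ^ 3; q ^ 3 %/ 2]].
Proof.
move=> F2 s11 n11 n3 free even N; have q1 := q_gt1 F; have q0 := ltnW q1.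
have q3 : 0 < q ^ 3 by rewrite expn_gt0 q0.
(* The division is exact because [q] is even in characteristic 2. *)
set h := q ^ 3 %/ 2; have d2 : h * 2 = q ^ 3.
  by apply: divnK; rewrite dvdn2 oddX /= odd_card_field F2 eqxx.
have h0 : 0 < h by move: q3; rewrite -d2 muln_gt0 => /andP[].
have nzb b : mulcoef b != 0%R -> b != (0, 0, 0)%R :> F * F * F.
  by apply: contraNneq => ->; rewrite /mulcoef /= !mulr0.
have nstabE (v : coefs F) : in_class s s' v ->
    nstab v = if dotp v.2 (stab_dir v.1.2) == 0%R then 1 else 2.
  move=> cv; have v11 := in_class_X11 s11 cv; move: cv; rewrite in_classE.
  case: v v11 => [[[b3 b11] b] w] /= -> /and3P[_ /even m0 _].
  exact: nstab_even.
split.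
- have := @class_count (q ^ 3) (fun b w => dotp w (stab_dir b) == 0%R)
    (q ^ 2) _ free _.
  rewrite n11 n3 -/N => e; apply/eqP; rewrite -(eqn_pmul2r (m := (q ^ 3) ^ 2)).
    rewrite e => [|v cv|b /even/nzb nz].
    + by apply/eqP; ring.
    + rewrite nstabE // -{2}[q ^ 3]muln1 eqn_pmul2l //.
      by case: ifP.
    + exact: card_dotp_eq0 (stab_dir_neq0 nz).
  by rewrite expn_gt0 q3.
- have := @class_count (h) (fun b w => dotp w (stab_dir b) != 0%R)
    (q ^ 2 * (q - 1)) _ free _.
  rewrite n11 n3 -/N => e; apply/eqP; rewrite -(eqn_pmul2r (m := (h) ^ 2)).
    rewrite e => [|v cv|b /even/nzb nz].
    (* Isolating the square of [q ^ 3 = h * 2] produces the factor 4 next to [h ^ 2]. *)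
    + have -> : q * 1 * N * (q ^ 2 * (q - 1)) * q ^ 3 = N * (q - 1) * (q ^ 3) ^ 2.
        by ring.
      by rewrite -d2; apply/eqP; ring.
    + by rewrite nstabE // -d2 eqn_pmul2l //; case: ifP.
    + exact: card_dotp_neq0 (stab_dir_neq0 nz).
  by rewrite expn_gt0 h0.
move=> i Pi; case/and5P: okss' => s12 ns ns' sB /andP[s'B _].
have [v cv [n ->]] := class_degree HU phiP phi_nt s12 ns ns' sB s'B defP Pi.
rewrite nstabE //; case: ifP => _ nE.
  by exists (q ^ 3); rewrite ?inE ?eqxx // -nE muln1.
exists (h); first by rewrite !inE eqxx orbT.
by congr (_%:R)%R; apply/eqP; rewrite -(eqn_pmul2r (isT : 0 < 2)) nE d2.
Qed.

End Counts.

End Class.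

End Families.

Lemma setinker_mulg (gT : finGroupType) (G : {group gT}) (A C : {set gT}) (i : Iirr G) :
    1%g \in A -> 1%g \in C ->
  D4setinker (A * C)%g i = D4setinker A i && D4setinker C i.
Proof.
move=> A1 C1; apply/idP/andP => [sAC|[sA sC]]; last exact: mul_subG.
split; apply: subset_trans sAC; first exact: mulg_subl.
exact: mulg_subr.
Qed.

Lemma root_set1 (gT : finGroupType) (F : finFieldType) (G : {group gT})
    (x : nat -> F -> gT) (HU : D4_unipotent G x) j :
  is_root j -> 1%g \in D4rootX x j.
Proof. by move=> rj; rewrite -(root_elt0 HU rj) imset_f. Qed.

(** A coordinate forced to be zero kills [mulcoef], and one forced to be nonzero keeps the vector
    from vanishing. *)
Local Ltac solve_mixed :=
  case=> [[b8 b9] b10]; rewrite /pattern3 /zero_pattern !inE /=;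
  rewrite !xpair_eqE /mulcoef /=;
  do 3![case: eqVneq => [->|_] //=] => _; split; rewrite ?mul0r ?mulr0 ?mul0r.

Lemma nstab_in_class_X567 (F : finFieldType) s s' (v : coefs F) :
    all [in s] (iota 8 4) -> has [in s'] [:: 5; 6; 7] -> in_class s s' v ->
  nstab v = #|F| ^ 2.
Proof.
move=> /allP s8 /hasP[j j567 s'j] /andP[/allP zs /allP/(_ j s'j) nzj].
have z k : k \in iota 8 4 -> coef_at v k = 0%R by move=> /s8/zs/eqP.
case: v {zs} nzj z => [[[b3 b11] [[b8 b9] b10]] [[b5 b6] b7]] nzj z.
have [/= z8 z9] := (z 8 isT, z 9 isT); have [/= z10 z11] := (z 10 isT, z 11 isT).
rewrite z8 z9 z10 z11; apply: nstab_X567; apply: contraNneq nzj => -[-> -> ->].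
by move: j567; rewrite !inE => /or3P[] /eqP->.
Qed.

Theorem theorem4p1 (gT : finGroupType) (F : finFieldType) (G : {group gT})
  (x : nat -> F -> gT) (HU : D4_unipotent G x) :
  let q := #|F| in
  let X := fun j => D4rootX x j in
  let ink := fun j (i : Iirr G) => D4inker x j i in
  (* 1 *)
      (let P := fun i => ~~ ink 12 i in
       D4ndeg P (q ^ 4) = q ^ 3 * (q - 1) /\ D4degs_in P [:: q ^ 4]) /\
      (* 2 *)
      (let P := fun i => ink 12 i && ~~ ink 11 i in
       D4ndeg P (q ^ 3) = q ^ 4 * (q - 1) /\ D4degs_in P [:: q ^ 3]) /\
      (* 3 *)
      (let P := fun i => D4setinker (X 11 * X 12)%g i &&
                  [&& ~~ ink 8 i, ~~ ink 9 i & ~~ ink 10 i] in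
       if odd q then (D4ndeg P (q ^ 3) = q * (q - 1) ^ 3 /\ D4degs_in P [:: q ^ 3])
       else [/\ D4ndeg P (q ^ 3) = (q - 1) ^ 3,
                D4ndeg P (q ^ 3 %/ 2) = 4 * (q - 1) ^ 4 &
                D4degs_in P [:: q ^ 3; q ^ 3 %/ 2]]) /\
      (* 4 *)
      (forall k, k \in [:: 8; 9; 10] ->
       let P := fun i => D4setinker (X k * X 11 * X 12)%g i &&
                  all (fun l => ~~ ink l i) [seq l <- [:: 8; 9; 10] | l != k] in
       [/\ D4ndeg P (q ^ 3) = (q - 1) ^ 3, D4ndeg P (q ^ 2) = q ^ 2 * (q - 1) ^ 2 &
           D4degs_in P [:: q ^ 3; q ^ 2]]) /\
      (* 5 *)
      (forall k, k \in [:: 8; 9; 10] ->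
       let P := fun i => all (fun j => ink j i) [seq j <- iota 8 5 | j != k] && ~~ ink k i in
       [/\ D4ndeg P (q ^ 3) = (q - 1) ^ 2, D4ndeg P (q ^ 2) = q ^ 2 * (q - 1) &
           D4degs_in P [:: q ^ 3; q ^ 2]]) /\
      (* 6 *)
      (let P := fun i => all (fun j => ink j i) (iota 8 5) &&
                  [&& ~~ ink 5 i, ~~ ink 6 i & ~~ ink 7 i] in
       D4ndeg P q = q ^ 2 * (q - 1) ^ 3 /\ D4degs_in P [:: q]) /\
      (* 7 *)
      (forall k, k \in [:: 5; 6; 7] ->
       let P := fun i => all (fun j => ink j i) (k :: iota 8 5) &&
                  all (fun l => ~~ ink l i) [seq l <- [:: 5; 6; 7] | l != k] in
       D4ndeg P q = q ^ 2 * (q - 1) ^ 2 /\ D4degs_in P [:: q]) /\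
      (* 8 *)
      (forall k, k \in [:: 5; 6; 7] ->
       let P := fun i => all (fun j => ink j i) [seq j <- iota 5 8 | j != k] && ~~ ink k i in
       D4ndeg P q = q ^ 2 * (q - 1) /\ D4degs_in P [:: q]) /\
      (* 9 *)
      (let P := fun i => all (fun j => ink j i) (iota 5 8) in
       D4ndeg P 1 = q ^ 4 /\ D4degs_in P [:: 1]).
Proof.
have [phi phiP phi_nt] := nontrivial_additive_character F.
move=> q X ink.
have X1 j : is_root j -> 1%g \in X j by apply: root_set1 HU j.
split; first split.
- exact: (ndeg_X12 HU phiP phi_nt).
- move=> i Pi; exists (q ^ 4); first by rewrite inE.
  exact: (irr1_X12 HU phiP phi_nt).
split.
  move=> P; apply: (class_single HU phiP phi_nt (s := [:: 12]) (s' := [:: 11]) isT _ (m := 1)).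
  - by move=> i; rewrite /= !andbT.
  - case=> [[u b] w] cv; apply: nstab_X11; move: cv.
    by case: u b w => [b3 b11] [[b8 b9] b10] [[b5 b6] b7] /andP[_ /andP[]].
  - exact: muln1.
  - by rewrite /npattern !inE /= -/q; ring.
split.
  move=> P.
  have defP : P =1 fun i => all (fun j => D4inker x j i) [:: 11; 12] &&
      all (fun j => ~~ D4inker x j i) [:: 8; 9; 10].
    by move=> i; rewrite /P setinker_mulg ?X1 //= !andbT.
  have nzb b : @pattern3 F [:: 11; 12] [:: 8; 9; 10] 8 9 10 b -> mulcoef b != 0%R.
    case: b => [[b8 b9] b10]; rewrite /pattern3 /zero_pattern !inE /=.
    by rewrite /mulcoef /= !mulf_eq0 !negb_or => /and3P[-> -> ->].
  (* In odd characteristic the linear system is nonsingular and stabilizers are trivial; in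
     characteristic 2 it degenerates to a line. *)
  case: ifPn; rewrite [odd q]odd_card_field.
    move=> n2; apply: (class_single HU phiP phi_nt _ defP (m := 1)) => //.
    - case=> [[u b] w] cv; have := in_class_X11 (s := [:: 11; 12]) isT cv; move: cv.
      rewrite in_classE //; case: u => [b3 b11] /= /and3P[_ /nzb nz _] ->.
      exact: nstab_odd.
    - exact: muln1.
    - by rewrite /npattern !inE /= -/q; ring.
  rewrite negbK => /eqP F2.
  have [] := class_even HU phiP phi_nt _ defP F2 _ _ _ _ nzb => //.
  rewrite /npattern !inE /= -/q => -> -> ?; split=> //; ring.
split.
  have setker3 k i : is_root k ->
      D4setinker (X k * X 11 * X 12)%g i = [&& ink k i, ink 11 i & ink 12 i].
    move=> rk; rewrite !setinker_mulg ?X1 ?andbA //.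
    by rewrite -[1%g]mulg1 mem_mulg ?X1.
  move=> k; rewrite !inE => /or3P[] /eqP-> P.
  - have defP : P =1 fun i => all (fun j => D4inker x j i) [:: 8; 11; 12] &&
        all (fun j => ~~ D4inker x j i) [:: 9; 10].
      by move=> i; rewrite /P setker3 //= !andbT.
    have [] := class_mixed HU phiP phi_nt _ defP => //; first by solve_mixed.
    by rewrite /npattern !inE /= -/q => -> -> ?; split=> //; ring.
  - have defP : P =1 fun i => all (fun j => D4inker x j i) [:: 9; 11; 12] &&
        all (fun j => ~~ D4inker x j i) [:: 8; 10].
      by move=> i; rewrite /P setker3 //= !andbT.
    have [] := class_mixed HU phiP phi_nt _ defP => //; first by solve_mixed.
    by rewrite /npattern !inE /= -/q => -> -> ?; split=> //; ring.
  - have defP : P =1 fun i => all (fun j => D4inker x j i) [:: 10; 11; 12] &&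
        all (fun j => ~~ D4inker x j i) [:: 8; 9].
      by move=> i; rewrite /P setker3 //= !andbT.
    have [] := class_mixed HU phiP phi_nt _ defP => //; first by solve_mixed.
    by rewrite /npattern !inE /= -/q => -> -> ?; split=> //; ring.
split.
  move=> k; rewrite !inE => /or3P[] /eqP-> P.
  - have defP : P =1 fun i => all (fun j => D4inker x j i) [:: 9; 10; 11; 12] &&
        all (fun j => ~~ D4inker x j i) [:: 8].
      by move=> i; rewrite /P /= !andbT.
    have [] := class_mixed HU phiP phi_nt _ defP => //; first by solve_mixed.
    by rewrite /npattern !inE /= -/q => -> -> ?; split=> //; ring.
  - have defP : P =1 fun i => all (fun j => D4inker x j i) [:: 8; 10; 11; 12] &&
        all (fun j => ~~ D4inker x j i) [:: 9].
      by move=> i; rewrite /P /= !andbT.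
    have [] := class_mixed HU phiP phi_nt _ defP => //; first by solve_mixed.
    by rewrite /npattern !inE /= -/q => -> -> ?; split=> //; ring.
  - have defP : P =1 fun i => all (fun j => D4inker x j i) [:: 8; 9; 11; 12] &&
        all (fun j => ~~ D4inker x j i) [:: 10].
      by move=> i; rewrite /P /= !andbT.
    have [] := class_mixed HU phiP phi_nt _ defP => //; first by solve_mixed.
    by rewrite /npattern !inE /= -/q => -> -> ?; split=> //; ring.
(* In the next three families the only remaining equation is one nonzero linear form, so the
   stabilizer has order [q ^ 2] and the degree is [q]. *)
have qq2 : q * q ^ 2 = q ^ 3 by [].
split.
  move=> P; have defP : P =1 fun i => all (fun j => D4inker x j i) (iota 8 5) &&
      all (fun j => ~~ D4inker x j i) [:: 5; 6; 7].
    by move=> i; rewrite /P /= !andbT.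
  apply: (class_single HU phiP phi_nt _ defP _ qq2) => //; first by move=> v; apply: nstab_in_class_X567.
  by rewrite /npattern !inE /= -/q; ring.
split.
  move=> k; rewrite !inE => /or3P[] /eqP-> P.
  - apply: (class_single HU phiP phi_nt (s := 5 :: iota 8 5) (s' := [:: 6; 7])
      isT _ _ qq2) => //; first by move=> v; apply: nstab_in_class_X567.
    by rewrite /npattern !inE /= -/q; ring.
  - apply: (class_single HU phiP phi_nt (s := 6 :: iota 8 5) (s' := [:: 5; 7])
      isT _ _ qq2) => //; first by move=> v; apply: nstab_in_class_X567.
    by rewrite /npattern !inE /= -/q; ring.
  - apply: (class_single HU phiP phi_nt (s := 7 :: iota 8 5) (s' := [:: 5; 6])
      isT _ _ qq2) => //; first by move=> v; apply: nstab_in_class_X567.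
    by rewrite /npattern !inE /= -/q; ring.
split.
  move=> k; rewrite !inE => /or3P[] /eqP-> P.
  - have defP : P =1 fun i => all (fun j => D4inker x j i) (6 :: 7 :: iota 8 5) &&
        all (fun j => ~~ D4inker x j i) [:: 5].
      by move=> i; rewrite /P /= !andbT.
    apply: (class_single HU phiP phi_nt _ defP _ qq2) => //; first by move=> v; apply: nstab_in_class_X567.
    by rewrite /npattern !inE /= -/q; ring.
  - have defP : P =1 fun i => all (fun j => D4inker x j i) (5 :: 7 :: iota 8 5) &&
        all (fun j => ~~ D4inker x j i) [:: 6].
      by move=> i; rewrite /P /= !andbT.
    apply: (class_single HU phiP phi_nt _ defP _ qq2) => //; first by move=> v; apply: nstab_in_class_X567.
    by rewrite /npattern !inE /= -/q; ring.
  - have defP : P =1 fun i => all (fun j => D4inker x j i) (5 :: 6 :: iota 8 5) &&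
        all (fun j => ~~ D4inker x j i) [:: 7].
      by move=> i; rewrite /P /= !andbT.
    apply: (class_single HU phiP phi_nt _ defP _ qq2) => //; first by move=> v; apply: nstab_in_class_X567.
    by rewrite /npattern !inE /= -/q; ring.
(* Only the coefficient at 3 is free and all of [T] stabilizes, so [m = q ^ 3] and the characters
   are linear. *)
move=> P; apply: (class_single HU phiP phi_nt (s := iota 5 8) (s' := [::])
  isT _ (m := q ^ 3)).
- by move=> i; rewrite /P /= !andbT.
- case=> [[[b3 b11] [[b8 b9] b10]] [[b5 b6] b7]]; rewrite /in_class /= eqxx !andbT.
  move=> /and5P[/eqP-> /eqP-> /eqP-> /eqP-> /and3P[/eqP-> /eqP-> /eqP->]].
  exact: nstab_linear.
- exact: mul1n.
- by rewrite /npattern !inE /= -/q; ring.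
Qed.
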